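(* Let $t>1$ be a real number. (a) There exists a field $K\subset\overline{\mathbb{Q}}$ such that its ring of integers $\mathcal{O}_K$ satisfies $\mathcal{N}_{\mathrm{house}}(\mathcal{O}_K)=t$ and $\#\{\alpha\in\mathcal{O}_K : \overline{|\alpha|}<t\}=\infty$. (b) There exist $M>t$ and a field $K\subset\overline{\mathbb{Q}}$ such that its ring of integers $\mathcal{O}_K$ satisfies $\mathcal{N}_{\mathrm{house}}(\mathcal{O}_K)=t$ and, for all $\epsilon>0$, $\#\{\alpha\in\mathcal{O}_K : \overline{|\alpha|}\le t \text{ or } t+\epsilon\le\overline{|\alpha|}<M\}<\infty$. (c) There exists a field $K\subset\overline{\mathbb{Q}}$ such that its ring of integers $\mathcal{O}_K$ satisfies $\mathcal{N}_{\mathrm{house}}(\mathcal{O}_K)=t$ and $\#\{\alpha\in\mathcal{O}_K : \overline{|\alpha|}\le t\}<\infty$, and such that for all $M>t$ and all small enough $\epsilon>0$ (i.e. for every $M>t$ there is $\epsilon_0>0$ such that for all $0<\epsilon<\epsilon_0$) one has $\#\{\alpha\in\mathcal{O}_K : t+\epsilon\le\overline{|\alpha|}<M\}=\infty$.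
   Context: $\overline{\mathbb{Q}}$ is the field of algebraic numbers. For a field $K\subset\overline{\mathbb{Q}}$ (possibly of infinite degree over $\mathbb{Q}$), $\mathcal{O}_K$ is the ring of all algebraic integers in $K$. The house of $\alpha\in\overline{\mathbb{Q}}$, written $\overline{|\alpha|}$, is the maximum of the complex absolute values of the conjugates of $\alpha$ over $\mathbb{Q}$. For $S\subset\overline{\mathbb{Q}}$ the Northcott number of $S$ with respect to the house is $\mathcal{N}_{\mathrm{house}}(S)=\inf\{X\in[0,\infty) : \#\{\alpha\in S : \overline{|\alpha|}<X\}=\infty\}\in[0,\infty]$, with $\inf\emptyset=\infty$. *)

(* Defs.v *)
From HB Require Import structures.
From mathcomp Require Import all_boot all_order all_algebra all_field.
From mathcomp Require Import complex.
From mathcomp Require Import boolp classical_sets cardinality reals ereal.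

Set Implicit Arguments.
Unset Strict Implicit.
Unset Printing Implicit Defensive.

Import Order.TTheory GRing.Theory Num.Theory.
Local Open Scope classical_set_scope.
Local Open Scope ring_scope.

(* The field of algebraic numbers is algC; the complex numbers are R[i] for
   R : realType, so that absolute values of conjugates are elements of R and
   can be compared with an arbitrary real number. *)

Definition minQpoly (a : algC) : {poly rat} := s2val (minCpolyP a).

Lemma minQpolyE a : minCpoly a = map_poly ratr (minQpoly a).
Proof. by rewrite /minQpoly; case: (minCpolyP a) => p /= [->]. Qed.

Lemma minQpoly_monic a : minQpoly a \is monic.
Proof. by rewrite /minQpoly; case: (minCpolyP a) => p /= []. Qed.

Lemma root_minQpoly_dvd a (q : {poly rat}) :
  root (map_poly ratr q) a = (minQpoly a %| q)%R.
Proof. by rewrite /minQpoly; case: (minCpolyP a) => p /= [_ _]. Qed.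

Definition conjugates (R : realType) (a : algC) : seq R[i] :=
  sval
    (closed_field_poly_normal (map_poly ratr (minQpoly a) : {poly R[i]})).

Lemma mem_conjugates (R : realType) (a : algC) (z : R[i]) :
  (z \in conjugates R a) = root (map_poly ratr (minQpoly a)) z.
Proof.
rewrite /conjugates; case: closed_field_poly_normal => r /= E.
rewrite [in RHS]E rootZ ?root_prod_XsubC// lead_coef_eq0 map_poly_eq0.
exact/monic_neq0/minQpoly_monic.
Qed.

(* Absolute values are nonnegative and there is at least one conjugate, so the
   neutral element 0 does not affect the maximum. *)
Definition house (R : realType) (a : algC) : R :=
  \big[Num.max/0]_(z <- conjugates R a) ComplexField.Normc.normc z.

(* As 0^-1 = 0, divring_closed K says exactly that K is a subfield. *)
Definition subfield_of_algC (K : {pred algC}) : Prop := divring_closed K.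

Definition ring_of_integers (K : {pred algC}) : set algC :=
  [set a | a \in K /\ a \in Aint].

Definition northcott_house (R : realType) (S : set algC) : \bar R :=
  ereal_inf [set X%:E | X in
    [set X : R | 0 <= X /\ infinite_set [set a | S a /\ house R a < X]]].

(* Main.v *)
Require Import Defs.
From mathcomp Require Import all_boot all_order all_algebra all_field.
From mathcomp Require Import cyclic complex zify ring lra.
From mathcomp Require Import boolp classical_sets cardinality.
From mathcomp Require Import reals ereal.

Set Implicit Arguments.
Unset Strict Implicit.
Unset Printing Implicit Defensive.

Import Order.TTheory GRing.Theory Num.Theory.
Local Open Scope classical_set_scope.
Local Open Scope ring_scope.

(** Each of the three fields is generated over the rationals by real radicals
    [pi_k = n_k ^ (1 / d_k)], where the [d_k] are distinct primes, the [n_k] are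
    squarefree and pairwise coprime, no [d_j] divides an [n_k], and
    [n_k ^ d_k <> n_k] modulo [d_k ^ 2].  Under these conditions the ring of
    integers is as simple as it can be: it is spanned over the integers by the
    monomials [mu = prod_k pi_k ^ e_k] with [0 <= e_k < d_k]
    ([Aint_combination]).  The last congruence condition makes the minimal
    polynomial of [pi_k - n_k] Eisenstein at [d_k], which excludes denominators
    divisible by [d_k] ([eisenstein_dvdz]); the other primes are excluded by
    taking traces and by squarefreeness.

    The conjugates of [sum_mu c_mu mu] are obtained by multiplying each [pi_k]
    by an arbitrary [d_k]-th root of unity.  Averaging their squared absolute
    values gives, by Parseval, [house(a) ^ 2 >= sum_mu c_mu ^ 2 |mu| ^ 2] for
    [a = sum_mu c_mu mu] ([parseval_house]).  As every [|pi_k|] is at least 1,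
    an integer of the field with house at most [X] only involves those [pi_k]
    with [|pi_k| <= X], and has bounded coefficients.  On the other hand
    [house(pi_k) = |pi_k|].  So the houses of the [pi_k] govern the Northcott
    number, and it is enough to place the [|pi_k|] suitably: below [t] and
    tending to [t] for (a); above [t] and tending to [t] for (b); above [t] and
    accumulating at [t + 1 / u] for every positive integer [u] for (c).  In (b),
    a nonconstant combination with two terms, with a coefficient other than 1
    and -1, or with a monomial of degree at least 2, has house at least
    [M = min (t ^ 2) (sqrt (t ^ 2 + 1))], so below [M] there are only the
    [pi_k], their opposites, and finitely many rational integers
    ([house_lt_eq_radical]).

    Numbers [d_k], [n_k] with [|pi_k|] in a prescribed interval [(a, b)] exist
    because [(b / a) ^ d] outgrows every polynomial in [d], which leaves room for
    a prime between [a ^ d] and [b ^ d] by Chebyshev's estimate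
    ([prime_between]).  If this prime [p] violates the congruence condition, it
    is replaced with [p q] for a small prime [q] that satisfies it
    ([nonwieferich_prime], [exists_radicand]).

    Since the [d_k] are pairwise coprime, the field generated by the first [m]
    radicals is generated by their product [theta].  By the Chinese remainder
    theorem the monomials are the [theta ^ j], for [0 <= j < prod_k d_k], divided
    by positive integers, so that all the computations take place with
    polynomials in one variable, and conjugating amounts to multiplying [theta]
    by a root of unity. *)

(** * Primes in short intervals and the choice of radicands *)

Section Primes.
Local Open Scope nat_scope.

(** By Legendre's formula the exponent of [p] is a sum, over the [k] with
    [p ^ k <= 2 n], of terms [2 n %/ p ^ k - 2 (n %/ p ^ k)], which are 0 or 1. *)
Lemma leq_pfactor_central_bin p n :
  prime p -> (0 < n)%N -> (p ^ logn p 'C(n.*2, n) <= n.*2)%N.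
Proof.
move=> p_pr n_gt0; have p_gt1 := prime_gt1 p_pr.
have n2_gt0 : (0 < n.*2)%N by rewrite double_gt0.
apply: leq_trans (trunc_logP p_gt1 n2_gt0); rewrite leq_pexp2l ?prime_gt0 //.
set T := trunc_log p n.*2.
have le_n : (n <= n.*2)%N by rewrite -addnn leq_addr.
have /(congr1 (logn p)) := bin_fact le_n.
rewrite -{2}addnn addnK lognM ?bin_gt0 ?muln_gt0 ?fact_gt0 //.
rewrite lognM ?fact_gt0 // !logn_fact //.
have -> : (\sum_(1 <= k < n.+1) n %/ p ^ k = \sum_(1 <= k < n.*2.+1) n %/ p ^ k)%N.
  rewrite [RHS](big_cat_nat (n := n.+1)) //= [X in _ = (_ + X)%N]big1_seq ?addn0 // => k.
  rewrite mem_index_iota => /andP[_ /andP[lt_nk _]].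
  by rewrite divn_small //; apply: leq_trans (ltn_expl k p_gt1); apply: ltnW.
have le_sum : (\sum_(1 <= k < n.*2.+1) n.*2 %/ p ^ k <=
   \sum_(1 <= k < n.*2.+1) n %/ p ^ k + \sum_(1 <= k < n.*2.+1) n %/ p ^ k +
   \sum_(1 <= k < n.*2.+1) (k <= T))%N.
  rewrite -!big_split; apply: leq_sum => k _.
  have pk_gt0 : (0 < p ^ k)%N by rewrite expn_gt0 prime_gt0.
  case: (leqP k T) => hk.
    rewrite -ltnS ltn_divLR //= {1}(divn_eq n (p ^ k)) -addnn.
    by have := ltn_pmod n pk_gt0; lia.
  rewrite divn_small //; apply: leq_trans (trunc_log_ltn _ p_gt1) _.
  by rewrite leq_pexp2l ?prime_gt0.
have : (\sum_(1 <= k < n.*2.+1) (k <= T) <= T)%N.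
  rewrite -big_mkcond /= sum1_count -size_filter.
  rewrite -[leqRHS](size_iota 1); apply: uniq_leq_size.
    by rewrite filter_uniq // iota_uniq.
  by move=> k; rewrite mem_filter mem_index_iota mem_iota; lia.
lia.
Qed.

Lemma expn2_leq_central_bin n : (2 ^ n <= 'C(n.*2, n))%N.
Proof.
elim: n => // n IHn; rewrite doubleS.
have e1 := mul_bin_diag n.*2.+2 n; have e2 := mul_bin_down n.*2.+1 n.
rewrite /= in e1 e2; rewrite expnS.
have e3 : (n.*2.+1 - n = n.+1)%N by lia.
rewrite e3 in e2; nia.
Qed.

(** Without such a prime, the central binomial coefficient, which is at least
    [2 ^ N], would be a product of at most [A] prime powers, each at most
    [2 N]. *)
Lemma prime_between A N :
  (0 < N)%N -> ((N.*2) ^ A < 2 ^ N)%N -> exists2 p, prime p & (A < p <= N.*2)%N.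
Proof.
move=> N_gt0 ltA.
set P := fun p => prime p && (A < p <= N.*2)%N.
case: (boolP (has P (iota 0 N.*2.+1))) => [/hasP[p _ /andP[? ?]]|]; first by exists p.
move=> /hasPn hN; exfalso.
set c := 'C(N.*2, N) in hN *.
have c_gt0 : (0 < c)%N by rewrite bin_gt0 -addnn leq_addr.
have := expn2_leq_central_bin N; rewrite -/c leqNgt => /negP; apply.
apply: leq_ltn_trans ltA.
rewrite {1}(prod_prime_decomp c_gt0) prime_decompE big_map /=.
apply: (@leq_trans (\prod_(p <- primes c) N.*2)%N).
  rewrite big_seq [leqRHS]big_seq; apply: leq_prod => p.
  by rewrite mem_primes => /and3P[p_pr _ _]; apply: leq_pfactor_central_bin.
rewrite big_const_seq count_predT iter_muln_1.
rewrite leq_pexp2l ?double_gt0 // -[leqRHS](size_iota 1).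
apply: uniq_leq_size (primes_uniq _) _ => p pc.
have := pc; rewrite mem_primes => /and3P[p_pr _ _].
have p_le : (p <= N.*2)%N.
  apply: leq_trans (leq_pfactor_central_bin p_pr N_gt0).
  by rewrite -[leqLHS]expn1 leq_pexp2l ?logn_gt0 ?(prime_gt0 p_pr).
have := hN p; rewrite mem_iota /P p_pr p_le /= add0n ltnS p_le => /(_ isT).
by rewrite andbT mem_iota -leqNgt add1n ltnS (prime_gt0 p_pr).
Qed.

(** The numbers [x] with [x ^ d = x] modulo [d ^ 2] are closed under products,
    and [1 + d Q] is not one of them since [(1 + d Q) ^ d = 1] modulo [d ^ 2].
    So some prime factor of [1 + d Q] is not one of them either.  What matters
    for the choice of radicands is that this factor is coprime to [d Q] and
    bounded by a polynomial in [d]. *)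
Lemma nonwieferich_prime d Q : prime d -> coprime d Q ->
  exists2 q, prime q & (q %| 1 + d * Q)%N && (q ^ d != q %[mod d ^ 2])%N.
Proof.
move=> d_pr dQ; have d_gt1 := prime_gt1 d_pr.
set x := (1 + d * Q)%N.
case: (boolP (all (fun q => q ^ d == q %[mod d ^ 2])%N (primes x))); last first.
  case/allPn => q; rewrite mem_primes => /and3P[? _ ?] ?; exists q => //.
  exact/andP.
move=> /allP hall; exfalso.
have closed y : (y %| x)%N -> (0 < y)%N -> (y ^ d = y %[mod d ^ 2])%N.
  elim/ltn_ind: y => y IH yx y0; have [y1|y1] := leqP y 1.
    by have -> : y = 1%N; [lia | rewrite exp1n].
  have /dvdnP[z zE] := pdiv_dvd y.
  have pp := pdiv_prime y1; have p1 := prime_gt1 pp.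
  have z0 : (0 < z)%N by nia.
  have zy : (z < y)%N by rewrite zE; nia.
  have zx : (z %| x)%N by apply: dvdn_trans yx; rewrite zE dvdn_mulr.
  have px : (pdiv y %| x)%N by apply: dvdn_trans yx; exact: pdiv_dvd.
  have /eqP ep : (pdiv y ^ d == pdiv y %[mod d ^ 2])%N.
    by apply: hall; rewrite mem_primes pp px.
  by rewrite zE expnMn -modnMm (IH z) // ep modnMm.
have /eqP := closed x (dvdnn _) isT.
have -> : (x ^ d = 1 %[mod d ^ 2])%N.
  rewrite expnDn big_ord_recl /= subn0 exp1n bin0 !mul1n expn0.
  rewrite -modnDmr -[in RHS](addn0 1%N); congr ((_ + _) %% _)%N.
  apply/eqP; apply: dvdn_sum => i _; rewrite exp1n mul1n.
  case: (posnP i) => [->|i_gt0]; first by rewrite bin1 -mulnn mulnA dvdn_mulr.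
  by rewrite dvdn_mull // expnMn dvdn_mulr // dvdn_exp2l.
rewrite -{1}(addn0 1%N) eqn_modDl mod0n.
rewrite eq_sym -/(dvdn _ _) -mulnn dvdn_pmul2l ?prime_gt0 //.
by move=> dd; move: dQ; rewrite prime_coprime // dd.
Qed.

End Primes.

(** The fourth power of Bernoulli's inequality for the exponent [d %/ 4]. *)
Lemma geometric_gt_cubic (R : realType) (r c : R) : 1 < r ->
  exists e, forall d, (e <= d)%N -> c * d%:R ^+ 3 < r ^+ d.
Proof.
move=> r1; pose h := r - 1; have h0 : 0 < h by rewrite subr_gt0.
have bern m : 1 + m%:R * h <= r ^+ m.
  elim: m => [|m IH]; first by rewrite mul0r addr0 expr0.
  have rE : r = 1 + h by rewrite /h addrC subrK.
  rewrite exprS -natr1; apply: le_trans (ler_wpM2l _ IH); last first.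
    by rewrite ltW // (lt_trans _ r1).
  have : 0 <= m%:R * h ^+ 2 by rewrite mulr_ge0 ?ler0n ?exprn_ge0 ?ltW.
  by rewrite rE; nra.
pose M := (Num.truncn (512 * `|c| / h ^+ 4)).+1.
have hM : 512 * `|c| <= M%:R * h ^+ 4.
  rewrite -ler_pdivrMr ?exprn_gt0 //; apply: ltW.
  by rewrite /M truncnS_gt.
exists (4 * M)%N => d le_d; pose m := (d %/ 4)%N.
have le_Mm : (M <= m)%N by rewrite leq_divRL // mulnC.
have m_gt0 : (0 < m)%N by apply: leq_trans le_Mm.
have dm8 : (d <= 8 * m)%N.
  by have := ltn_ceil d (isT : (0 < 4)%N); rewrite -/m; lia.
have dm4 : (m * 4 <= d)%N by rewrite leq_trunc_div.
apply: le_lt_trans (_ : `|c| * (8 * m%:R) ^+ 3 < _).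
  apply: le_trans (ler_wpM2r _ (ler_norm c)) _; first by rewrite exprn_ge0.
  by rewrite ler_wpM2l // lerXn2r ?nnegrE ?mulr_ge0 // -natrM ler_nat.
apply: lt_le_trans (_ : (1 + m%:R * h) ^+ 4 <= _); last first.
  apply: le_trans (_ : r ^+ (m * 4) <= _).
    rewrite exprM lerXn2r ?nnegrE ?addr_ge0 ?mulr_ge0 ?(ltW h0) ?exprn_ge0 //.
    by rewrite ltW // (lt_trans _ r1).
  by rewrite ler_weXn2l // ltW.
apply: le_lt_trans (_ : (m%:R * h) ^+ 4 < _); last first.
  by rewrite ltrXn2r ?nnegrE ?addr_ge0 ?mulr_ge0 ?(ltW h0) // ltrDr.
rewrite !exprMn; have -> : 8 ^+ 3 = 512 :> R by ring.
rewrite mulrCA mulrA (exprSr m%:R 3) -[leRHS]mulrA [leLHS]mulrC.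
rewrite ler_wpM2l ?exprn_ge0 //; apply: le_trans hM _.
by rewrite ler_wpM2r ?ler_nat // exprn_ge0 // ltW.
Qed.

Lemma nonwieferichM d p q : prime d -> coprime p d ->
  p ^ d = p %[mod d ^ 2] -> q ^ d != q %[mod d ^ 2] ->
  (p * q) ^ d != p * q %[mod d ^ 2].
Proof.
move=> d_pr pd pW; apply: contra => /eqP; rewrite expnMn -modnMml pW modnMml.
move=> /eqP; case/orP: (leq_total (q ^ d) q) => le_q.
  rewrite eq_sym eqn_mod_dvd ?leq_mul2l ?le_q ?orbT // -mulnBr Gauss_dvdr.
    by rewrite eq_sym eqn_mod_dvd.
  by rewrite coprime_sym coprimeXr.
rewrite eqn_mod_dvd ?leq_mul2l ?le_q ?orbT // -mulnBr Gauss_dvdr.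
  by rewrite eqn_mod_dvd.
by rewrite coprime_sym coprimeXr.
Qed.

(** Bertrand-type existence with side conditions: for a large prime [d], the
    interval from [a ^ d] to [b ^ d] is so long that it contains a prime [p]
    together with [p * (1 + d * Q)], hence with [p * q] for the prime [q] of
    [nonwieferich_prime].  One of [p] and [p * q] satisfies the congruence
    condition by [nonwieferichM]. *)
Lemma exists_radicand (R : realType) (a b : R) Q : 1 <= a -> a < b -> (0 < Q)%N ->
  exists d n, [/\ prime d, coprime d Q & coprime n (Q * d)] /\
   [/\ (1 < n)%N, forall q, (logn q n <= 1)%N, n ^ d != n %[mod d ^ 2] &
    a ^+ d < n%:R < b ^+ d].
Proof.
move=> a1 ab Q0; have a0 : 0 < a by apply: lt_le_trans a1.
have b0 : 0 < b by apply: lt_trans ab.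
have [C hC] : exists C, b <= 2 ^+ C.
  exists (Num.truncn b).+1; rewrite -natrX.
  apply: le_trans (ltW (truncnS_gt _)) _; rewrite ler_nat.
  exact: ltnW (ltn_expl _ _).
(* [c * d ^ 3] bounds the factor by which [b ^ d] has to exceed [a ^ d] to leave
   room for [N.*2 * (1 + d * Q)], with [A] and [N] as below. *)
pose c := (2 * (C + 1) * (2 + Q) ^ 2)%N.
have [|e he] := @geometric_gt_cubic R (b / a) c%:R.
  rewrite ltr_pdivlMr ?mul1r //.
have [d lt_d d_pr] := prime_above (e + Q); exists d.
have d_gt1 := prime_gt1 d_pr.
have dQ : coprime d Q.
  by rewrite prime_coprime // gtnNdvd //; lia.
have [q q_pr /andP[q_dvd q_nW]] := nonwieferich_prime d_pr dQ.
have q_le : (q <= 1 + d * Q)%N by apply: dvdn_leq.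
(* A prime above [A] exceeds [a ^ d] and, being larger than [1 + d * Q], is
   distinct from [q] and coprime to [Q * d].  The value of [N] is the least one for which
   [prime_between] applies, given that [N.*2 < 2 ^ (C * d)]. *)
pose A := ((Num.truncn (a ^+ d)).+1 + d * Q)%N.
have [N NE] : exists N, N = (C * d * A + 1)%N by exists (C * d * A + 1)%N.
have A_le : A%:R <= a ^+ d * (2 + d * Q)%:R :> R.
  rewrite /A natrD -natr1 !natrD mulrDr mulr_natr mulr2n.
  have h1 : 1 <= a ^+ d by rewrite exprn_ege1.
  apply: lerD; last by rewrite ler_peMl.
  by apply: lerD => //; rewrite truncn_le exprn_ge0 // ltW.
have N_lt : ((N.*2) * (1 + d * Q))%:R < b ^+ d :> R.
  have : c%:R * d%:R ^+ 3 < (b / a) ^+ d by apply: he; apply: leq_trans (ltnW lt_d); rewrite leq_addr.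
  rewrite expr_div_n ltr_pdivlMr ?exprn_gt0 //; apply: le_lt_trans.
  apply: le_trans (_ : (2 * (C * d + 1) * (2 + d * Q))%:R * A%:R <= _).
    have le_N : (N <= (C * d + 1) * A)%N.
      by rewrite NE mulnDl leq_add2l mul1n /A addSn.
    rewrite -natrM ler_nat -mul2n.
    apply: leq_trans (_ : 2 * ((C * d + 1) * A) * (2 + d * Q) <= _)%N.
      by rewrite !leq_mul // ltnW.
    by rewrite mulnA mulnAC.
  apply: le_trans (ler_wpM2l _ A_le) _; first by [].
  rewrite mulrCA mulrC ler_wpM2r ?exprn_ge0 ?(ltW a0) //.
  rewrite -natrX -!natrM ler_nat /c.
  have h1 : (C * d + 1 <= (C + 1) * d)%N by rewrite mulnDl leq_add2l mul1n ltnW.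
  have h2 : (2 + d * Q <= (2 + Q) * d)%N by rewrite mulnDl (mulnC Q) leq_add2r leq_pmulr // prime_gt0.
  apply: leq_trans (_ : 2 * ((C + 1) * d) * (((2 + Q) * d) * ((2 + Q) * d)) <= _)%N.
    by rewrite -mulnA !leq_mul.
  rewrite -!mulnn !expnS expn0 muln1.
  by rewrite leq_eqVlt; apply/orP; left; apply/eqP; ring.
have N2_lt : (N.*2)%:R < b ^+ d.
  by apply: le_lt_trans N_lt; rewrite ler_nat leq_pmulr.
have [||p p_pr /andP[A_lt_p p_le]] := @prime_between A N.
- by rewrite NE addn1.
- have : ((N.*2) < 2 ^ (C * d))%N.
    rewrite -(ltr_nat R) natrX exprM; apply: lt_le_trans N2_lt _.
    by rewrite lerXn2r ?nnegrE ?(ltW b0) ?exprn_ge0.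
  move=> h; apply: leq_ltn_trans (_ : 2 ^ (C * d * A) < _)%N.
    by rewrite (expnM 2) leq_exp2r // ltnW.
  by rewrite NE ltn_exp2l // addn1.
have ad_lt_p : a ^+ d < p%:R.
  apply: lt_le_trans (truncnS_gt _) _; rewrite ler_nat.
  by apply: leq_trans (ltnW A_lt_p); rewrite leq_addr.
have p_gt : (1 + d * Q < p)%N by apply: leq_ltn_trans A_lt_p; rewrite leq_add2r.
have p_cop x : (0 < x)%N -> (x < p)%N -> coprime p x.
  by move=> x0 xp; rewrite prime_coprime // gtnNdvd.
have pQd : coprime p (Q * d).
  apply: p_cop; first by rewrite muln_gt0 Q0 prime_gt0.
  by apply: ltn_trans p_gt; rewrite mulnC add1n.
have q_cop : coprime q (Q * d).
  apply: (coprime_dvdl q_dvd); rewrite mulnC.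
  by rewrite /coprime gcdnC gcdnDr gcdn1.
have p1 := prime_gt1 p_pr; have q1 := prime_gt1 q_pr.
have [pW|pW] := eqVneq (p ^ d %% d ^ 2)%N (p %% d ^ 2)%N; last first.
  exists p; split=> //; split=> //; first by move=> r; rewrite logn_prime ?leq_b1.
  by rewrite ad_lt_p (le_lt_trans _ N2_lt) // ler_nat.
exists (p * q)%N; split=> //; first by rewrite coprimeMl pQd.
split.
- by apply: leq_trans p1 _; rewrite leq_pmulr // prime_gt0.
- move=> r; rewrite lognM ?prime_gt0 // !logn_prime //.
  have pq : p != q by apply: contraTneq p_gt => ->; rewrite -leqNgt.
  by case: (r =P p) => [->|_]; [rewrite (negPf pq) | case: (r == q)].
- by apply: nonwieferichM => //; apply: coprime_dvdr pQd; apply: dvdn_mull.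
- apply/andP; split; first by apply: lt_le_trans ad_lt_p _; rewrite ler_nat leq_pmulr // prime_gt0.
  apply: le_lt_trans N_lt; rewrite ler_nat.
  by rewrite leq_mul.
Qed.

Section RadicalSystems.
Local Open Scope nat_scope.

(** [rs_sqfree] and [rs_nonwief] are the local conditions, at the prime divisors
    of [n k] and at [d k], under which the powers of [n k ^ (1 / d k)] form an
    integral basis; the coprimality conditions separate the ramification of the
    different radicals. *)
Record radical_system (d n : nat -> nat) : Prop := RadicalSystem {
  rs_prime k : prime (d k);
  rs_gt1 k : 1 < n k;
  rs_sqfree k q : logn q (n k) <= 1;
  rs_nonwief k : n k ^ d k != n k %[mod d k ^ 2];
  rs_coprime_dd j k : j != k -> coprime (d j) (d k);
  rs_coprime_nn j k : j != k -> coprime (n j) (n k);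
  rs_coprime_dn j k : coprime (d j) (n k) }.

(** The pairs [(d k, n k)] are chosen one after the other, [Q k] being the
    product of all the earlier [d j] and [n j]. *)
Lemma exists_radical_system (R : realType) (a b : nat -> R) :
  (forall k, (1 <= a k)%R) -> (forall k, (a k < b k)%R) ->
  exists d n, radical_system d n /\
    forall k, (a k ^+ d k < (n k)%:R < b k ^+ d k)%R.
Proof.
move=> a1 ab.
have step (kQ : nat * nat) : exists dn : nat * nat, 0 < kQ.2 ->
    [/\ prime dn.1, coprime dn.1 kQ.2 & coprime dn.2 (kQ.2 * dn.1)] /\
    [/\ 1 < dn.2, forall q, logn q dn.2 <= 1, dn.2 ^ dn.1 != dn.2 %[mod dn.1 ^ 2] &
    (a kQ.1 ^+ dn.1 < dn.2%:R < b kQ.1 ^+ dn.1)%R].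
  case: kQ => k [|Q]; first by exists (0, 0).
  have [d [n H]] := exists_radicand (a1 k) (ab k) (ltn0Sn Q).
  by exists (d, n) => _.
have [f fP] := choice step.
pose Q := fix Q k := if k is j.+1 then Q j * ((f (j, Q j)).1 * (f (j, Q j)).2) else 1.
pose d k := (f (k, Q k)).1; pose n k := (f (k, Q k)).2.
have Q_gt0 k : 0 < Q k.
  elim: k => //= k IH; have [[dp _ _] [n1 _ _ _]] := fP (k, Q k) IH.
  by rewrite !muln_gt0 IH prime_gt0 // ltnW.
have dvd_Q j k : j < k -> d j * n j %| Q k.
  elim: k => // k IH; rewrite ltnS leq_eqVlt => /predU1P[->|/IH h] /=.
    exact: dvdn_mull.
  exact: dvdn_mulr.
have cop j k : j < k -> coprime (d j * n j) (d k * n k).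
  move=> jk; have [[dp dQ nQ] _] := fP (k, Q k) (Q_gt0 k).
  apply: coprime_dvdl (dvd_Q j k jk) _; rewrite coprime_sym coprimeMl dQ /=.
  by apply: coprime_dvdr nQ; apply: dvdn_mulr.
have cop' j k : j != k -> coprime (d j * n j) (d k * n k).
  by rewrite neq_ltn => /orP[/cop//|/cop]; rewrite coprime_sym.
exists d, n; split; last first.
  by move=> k; have [_ []] := fP (k, Q k) (Q_gt0 k).
split; try by move=> k; have [[? ? ?] []] := fP (k, Q k) (Q_gt0 k).
- by move=> j k /cop'; rewrite coprimeMl !coprimeMr => /andP[/andP[]].
- by move=> j k /cop'; rewrite coprimeMl !coprimeMr => /andP[_ /andP[]].
- move=> j k; have [->|/cop'] := eqVneq j k.
    have [[_ _ h] _] := fP (k, Q k) (Q_gt0 k).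
    by rewrite coprime_sym; apply: coprime_dvdr h; apply: dvdn_mull.
  by rewrite coprimeMl !coprimeMr => /andP[/andP[]].
Qed.

End RadicalSystems.

(** * Maximality at p of the order generated by a p-th root *)

Lemma Aint_divz (q : nat) (z : int) : (0 < q)%N ->
  (z%:~R / q%:R \in Aint) = (q %| z)%Z.
Proof.
move=> q_gt0; have q0 : q%:R != 0 :> algC by rewrite pnatr_eq0 -lt0n.
apply/idP/idP => [zA|/dvdzP[k ->]]; last first.
  by rewrite intrM pmulrn mulfK ?Aint_int.
have /Num.Theory.intrP[k kE] : (z%:~R / q%:R : algC) \in Num.int.
  apply: Cint_rat_Aint zA; apply: rpred_div; first exact: rpred_int.
  exact: rpred_nat.
apply/dvdzP; exists k; apply: (intr_inj (R := algC)).
by rewrite intrM -kE pmulrn divfK.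
Qed.

Lemma prime_dvdz_expn (q e : nat) (z : int) : prime q -> (q %| z ^+ e)%Z -> (q %| z)%Z.
Proof.
by move=> q_pr; rewrite !dvdzE abszX /= Euclid_dvdX // => /andP[].
Qed.

Lemma Aint_expr_nat (x : algC) e N : (0 < e)%N -> x ^+ e = N%:R -> x \in Aint.
Proof.
move=> e_gt0 xX; apply: (@root_monic_Aint ('X^e - N%:R%:P)).
- by rewrite rootE !hornerE xX subrr.
- exact: monicXnsubC.
- apply/polyOverP => i; rewrite coefB coefXn coefC rpredB ?rpred_nat //.
  by case: ifP; rewrite ?rpred_nat ?rpred0.
Qed.

Section EisensteinShift.
Variables (q n : nat) (x : algC).
Hypotheses (q_pr : prime q) (xX : x ^+ q = n%:R).
Hypothesis n_nW : n ^ q != n %[mod q ^ 2].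

Let q_gt0 : (0 < q)%N. Proof. exact: prime_gt0. Qed.
Let q_neq0 : q%:R != 0 :> algC. Proof. by rewrite pnatr_eq0 -lt0n. Qed.
Let lam := x - n%:R.

Let x_Aint : x \in Aint.
Proof. exact: Aint_expr_nat q_gt0 xX. Qed.

Let lam_Aint : lam \in Aint.
Proof. by rewrite rpredB ?rpred_nat. Qed.

(** Expanding [(lam + n) ^ q = n]: the extreme terms give
    [lam ^ q = - (n ^ q - n)] up to multiples of [q lam], and
    [w = (n ^ q - n) / q] is prime to [q] by hypothesis. *)
Lemma shift_exprE : exists w s,
  [/\ ~~ (q %| w)%N, s \in Aint & lam ^+ q = - q%:R * (w%:R + lam * s)].
Proof.
have le_n : (n <= n ^ q)%N.
  by case: (n) => // n'; rewrite -[leqLHS]expn1 leq_pexp2l.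
have /dvdnP[w wE] : (q %| n ^ q - n)%N.
  by rewrite -eqn_mod_dvd //; apply/eqP/fermat_little.
exists w, (\sum_(i < q.-1) ('C(q, i.+1) %/ q)%N%:R * (lam ^+ (q.-2 - i) * n%:R ^+ i.+1)).
split.
- move: n_nW; rewrite eqn_mod_dvd // wE; apply: contra.
  by rewrite -mulnn dvdn_pmul2r.
- by apply: rpred_sum => i _; rewrite !rpredM ?rpredX ?rpred_nat.
have q_gt1 := prime_gt1 q_pr.
have qsub u : (u < q.-1)%N -> (q - u.+1 = (q.-2 - u).+1)%N.
  by case: (q) q_gt1 => [|[|q']] //= _ lt_u; rewrite subSS subSn.
have nqE : n%:R ^+ q = n%:R + (w * q)%:R :> algC.
  by rewrite -wE -natrX -natrD subnKC.
have : x = lam + n%:R by rewrite subrK.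
move=> /(congr1 (fun u => u ^+ q)); rewrite xX exprDn.
have qE : q.+1 = q.-1.+2 by rewrite prednK.
rewrite qE big_ord_recl big_ord_recr /= subn0 bin0 mulr1 mulr1n.
rewrite /bump /= !add1n (prednK q_gt0) binn subnn mul1r nqE mulr1n.
set S := \sum_(i < _) _; set T := \sum_(i < _) _.
have -> : S = q%:R * (lam * T).
  rewrite !mulr_sumr; apply: eq_bigr => i _.
  rewrite /bump /= add1n -[LHS]mulr_natr.
  have i_lt : (0 < i.+1 < q)%N by rewrite /= -ltn_predRL ltn_ord.
  rewrite -{1}(divnK (prime_dvd_bin q_pr i_lt)) natrM.
  rewrite qsub //.
  rewrite exprS; move: (_%:R) (lam ^+ _) (n%:R ^+ _) => u v w'; ring.
rewrite natrM; move=> h.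
have -> : lam ^+ q = (lam ^+ q + (q%:R * (lam * T) + (n%:R + w%:R * q%:R)))
   - n%:R - w%:R * q%:R - q%:R * (lam * T) by ring.
rewrite -h; ring.
Qed.

(** Multiplying by [lam] and using [lam ^ q = - q (w + lam s)], one finds that
    [c w] is a multiple of [lam] among the algebraic integers.  Hence
    [(c w) ^ q] is a multiple of [lam ^ q], so of [q]. *)
Lemma dvdz_lam_exp (c : int) : c%:~R * lam ^+ q.-1 / q%:R \in Aint -> (q %| c)%Z.
Proof.
have [w [s [qw sA lamE]]] := shift_exprE.
move gE: (_ / _) => g gA.
have cwE : (c * w)%:~R = - lam * (g + c%:~R * s).
  rewrite intrM -pmulrn; apply: (mulfI q_neq0).
  rewrite !mulrDr !mulNr [_ * - (_ * g)]mulrN (mulrCA q%:R lam g).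
  have -> : lam * (q%:R * g) = c%:~R * lam ^+ q.
    by rewrite -gE [q%:R * _]mulrC divfK // mulrCA -exprS prednK.
  rewrite lamE; ring.
have : (q %| (c * w%:Z) ^+ q)%Z.
  rewrite -Aint_divz // rmorphXn /= cwE exprMn exprNn lamE.
  rewrite (_ : _ / _ = (-1) ^+ q * (-1) * (w%:R + lam * s) * (g + c%:~R * s) ^+ q).
    by rewrite !rpredM ?rpredX ?rpredD ?rpredM ?rpredN ?rpred1 ?rpred_nat ?Aint_int.
  by field.
move/(prime_dvdz_expn q_pr); rewrite dvdzE abszM /= Euclid_dvdM // (negPf qw) orbF.
by rewrite dvdzE.
Qed.

(** The coefficients of [h] are treated from the lowest upwards: multiplied by
    a suitable power of [lam], all terms but the lowest become multiples of
    [lam ^ q], hence of [q]. *)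
Lemma shift_dvdp (h : {poly int}) j : (size h <= q - j)%N ->
  lam ^+ j * (map_poly intr h).[lam] / q%:R \in Aint ->
  exists g, h = q%:Z *: g.
Proof.
elim/poly_ind: h j => [|h c IH] j; first by exists 0; rewrite scaler0.
rewrite size_MXaddC; case: ifP => [/andP[/eqP-> /eqP->] _ _|_ sz_h].
  by exists 0; rewrite scaler0 mul0r add0r polyC0.
rewrite rmorphD rmorphM /= map_polyX map_polyC /= !hornerE => hA.
have j_lt : (j < q)%N by rewrite -subn_gt0; apply: leq_ltn_trans sz_h.
have le_j : (j <= q.-1)%N by rewrite -ltnS prednK.
have hlamA : (map_poly intr h).[lam] \in Aint.
  apply: rpred_horner => //; apply/polyOverP => i.
  by rewrite coef_map Aint_int.
have lamqA : lam ^+ q / q%:R \in Aint.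
  have [w [s [_ sA ->]]] := shift_exprE.
  rewrite (_ : _ / _ = - (w%:R + lam * s)); last by field.
  by rewrite rpredN rpredD ?rpredM ?rpred_nat.
have /dvdzP[c' cE] : (q %| c)%Z.
  apply: dvdz_lam_exp.
  have -> : c%:~R * lam ^+ q.-1 / q%:R = lam ^+ (q.-1 - j) *
       (lam ^+ j * ((map_poly intr h).[lam] * lam + c%:~R) / q%:R) -
       (map_poly intr h).[lam] * (lam ^+ q / q%:R).
    have e1 : lam ^+ q = lam ^+ (q.-1 - j) * lam ^+ j * lam.
      by rewrite -exprD subnK // -exprSr prednK.
    have e2 : lam ^+ q.-1 = lam ^+ (q.-1 - j) * lam ^+ j.
      by rewrite -exprD subnK.
    by rewrite e1 e2; field.
  by rewrite rpredB // rpredM // rpredX.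
have [g gE] : exists g, h = q%:Z *: g.
  apply: (IH j.+1); first by rewrite subnS -ltnS prednK // subn_gt0.
  have -> : lam ^+ j.+1 * (map_poly intr h).[lam] / q%:R =
     lam ^+ j * ((map_poly intr h).[lam] * lam + c%:~R) / q%:R -
     lam ^+ j * (c%:~R / q%:R) by rewrite exprS; field.
  by rewrite rpredB // rpredM ?rpredX // Aint_divz // cE dvdz_mull.
exists (g * 'X + c'%:P).
by rewrite gE cE scalerDr -scalerAl -[_ *: c'%:P]mul_polyC -polyCM (mulrC c').
Qed.

(** The order generated by [x] is maximal at [q]: the minimal polynomial of
    [x - n] is Eisenstein at [q]. *)
Lemma eisenstein_dvdz (b : nat -> int) :
  (\sum_(i < q) (b i)%:~R * x ^+ i) / q%:R \in Aint ->
  forall i, (i < q)%N -> (q %| b i)%Z.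
Proof.
pose f := \poly_(i < q) b i; pose h := f \Po ('X + n%:R%:P) => bA.
have hE : (map_poly intr h).[lam] = \sum_(i < q) (b i)%:~R * x ^+ i.
  rewrite map_comp_poly horner_comp rmorphD /= map_polyX map_polyC /= !hornerE.
  rewrite rmorph_nat subrK /f poly_def rmorph_sum horner_sum.
  by apply: eq_bigr => i _ /=; rewrite map_polyZ map_polyXn hornerZ hornerXn.
have [||g gE] := @shift_dvdp h 0.
- rewrite subn0 size_comp_poly2 ?size_poly //.
  by rewrite size_XaddC.
- by rewrite expr0 mul1r hE.
have fE : f = q%:Z *: (g \Po ('X - n%:R%:P)).
  rewrite -comp_polyZ -gE /h -comp_polyA comp_polyD comp_polyX comp_polyC.
  by rewrite subrK comp_polyXr.
move=> i lt_i; have := congr1 (fun p : {poly int} => p`_i) fE.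
by rewrite coef_poly lt_i coefZ => ->; apply: dvdz_mulr.
Qed.

End EisensteinShift.

(** * Compositums of radical extensions: degree and integral basis *)

Lemma sum_prim_root_expr (F : fieldType) e (z : F) j k : e.-primitive_root z ->
  \sum_(i < e) (z ^+ j / z ^+ k) ^+ i = (j == k %[mod e])%:R * e%:R.
Proof.
move=> z_prim; have e_gt0 := prim_order_gt0 z_prim.
have z_neq0 : z != 0.
  apply/eqP => z0; have := prim_expr_order z_prim.
  by rewrite z0 expr0n eqn0Ngt e_gt0 => /eqP; rewrite eq_sym oner_eq0.
rewrite -(eq_prim_root_expr z_prim); have [->|zjk] := eqVneq.
  rewrite divff ?expf_neq0 // mul1r (eq_bigr (fun=> 1)) => [|i _].
    by rewrite sumr_const card_ord.
  by rewrite expr1n.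
rewrite mul0r; apply/eqP.
have w1 : z ^+ j / z ^+ k - 1 != 0.
  rewrite subr_eq0; apply: contra zjk => /eqP h.
  by rewrite -[_ ^+ j](divfK (expf_neq0 k z_neq0)) h mul1r.
rewrite -(mulrI_eq0 _ (lregP w1)) -subrX1 expr_div_n -!exprM mulnC exprM.
by rewrite (mulnC k) exprM (prim_expr_order z_prim) !expr1n divr1 subrr.
Qed.

(** Clears denominators, so that valuations can be computed on natural
    numbers. *)
Lemma rat_pow_eq (x : rat) (e N r : nat) : x != 0 -> `|x| ^+ e = N%:R ^+ r ->
  exists a b, [/\ (0 < a)%N, (0 < b)%N & a ^ e = b ^ e * N ^ r]%N.
Proof.
move=> x0 xE; exists `|numq x|%N, `|denq x|%N.
have b0 : (0 < `|denq x|)%N by rewrite absz_gt0 denq_neq0.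
split=> //; first by rewrite absz_gt0 numq_eq0.
apply/eqP; rewrite -(eqr_nat rat) natrM !natrX -xE.
rewrite -{3}(divq_num_den x) normf_div !expr_div_n.
have nE (z : int) : (`|z|%N)%:R = `|z%:~R| :> rat.
  by rewrite -[LHS]/((`|z|%N%:Z)%:~R) abszE intr_norm.
by rewrite !nE mulrC divfK // expf_neq0 // -nE pnatr_eq0 -lt0n.
Qed.

Section RadicalTower.
Variables d n : nat -> nat.
Hypothesis sys : radical_system d n.

Let d_pr := rs_prime sys.
Let d_gt0 k : (0 < d k)%N. Proof. exact: prime_gt0. Qed.
Let n_gt0 k : (0 < n k)%N. Proof. exact: ltnW (rs_gt1 sys k). Qed.

(** With [theta] the product of the first [m] radicals, [radicand m] is
    [theta ^ deg m], and [content m j] is the integer split off from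
    [theta ^ j] when the exponent [j] of each radical is reduced modulo
    [d k]. *)
Definition deg m := (\prod_(k < m) d k)%N.
Definition radicand m := (\prod_(k < m) n k ^ (deg m %/ d k))%N.
Definition content m j := (\prod_(k < m) n k ^ (j %/ d k))%N.

Lemma deg_gt0 m : (0 < deg m)%N.
Proof. by rewrite prodn_gt0. Qed.

Lemma dvd_deg m k : (k < m)%N -> (d k %| deg m)%N.
Proof. by move=> km; rewrite /deg (bigD1 (Ordinal km)) //= dvdn_mulr. Qed.

Lemma deg_dvd m x : (forall k, (k < m)%N -> (d k %| x)%N) -> (deg m %| x)%N.
Proof.
rewrite /deg; elim: m => [|m IH] h; first by rewrite big_ord0 dvd1n.
rewrite big_ord_recr /= Gauss_dvd ?h ?andbT ?IH // => [k km|].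
  exact/h/ltnW.
elim/big_rec: _ => [|i y _ cx]; rewrite ?coprime1n // coprimeMl cx andbT; apply: rs_coprime_dd sys _ _ _.
by rewrite ltn_eqF.
Qed.

Lemma content_gt0 m j : (0 < content m j)%N.
Proof. by apply: prodn_gt0 => k; rewrite expn_gt0 n_gt0. Qed.

Lemma radicand_gt0 m : (0 < radicand m)%N.
Proof. by apply: prodn_gt0 => k; rewrite expn_gt0 n_gt0. Qed.

Lemma logn_prod_expn m k p (e : nat -> nat) : (k < m)%N -> prime p ->
  (p %| n k)%N -> logn p (\prod_(i < m) n i ^ e i)%N = e k.
Proof.
move=> km p_pr pn; rewrite (bigD1 (Ordinal km)) //=.
rewrite mulnC logn_Gauss; last first.
  elim/big_rec: _ => [|i x]; rewrite ?coprimen1 // -val_eqE /= => ik cx.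
  rewrite coprimeMr cx andbT coprimeXr //; apply: coprime_dvdl pn _.
  by apply: rs_coprime_nn sys _ _ _; rewrite eq_sym.
rewrite lognX (_ : logn p (n k) = 1%N) ?muln1 //.
by apply/eqP; rewrite eqn_leq (rs_sqfree sys) /= logn_gt0 mem_primes p_pr n_gt0.
Qed.

Definition theta (A : comNzRingType) (rho : nat -> A) m := \prod_(k < m) rho k.
(** By the Chinese remainder theorem, an index [j] less than [deg m] encodes an
    arbitrary family of exponents [e k < d k]. *)
Definition mono (A : comNzRingType) (rho : nat -> A) m j :=
  \prod_(k < m) rho k ^+ (j %% d k).

Section Monomials.
Variables (F : numClosedFieldType) (rho : nat -> F).
Hypothesis rhoX : forall k, rho k ^+ d k = (n k)%:R.

Lemma thetaX m j : theta rho m ^+ j = (content m j)%:R * mono rho m j.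
Proof.
rewrite /theta -prodrXl natr_prod -big_split /=; apply: eq_bigr => k _.
by rewrite {1}(divn_eq j (d k)) exprD mulnC exprM rhoX natrX.
Qed.

Lemma theta_deg m : theta rho m ^+ deg m = (radicand m)%:R.
Proof.
rewrite /theta -prodrXl natr_prod; apply: eq_bigr => k _.
by rewrite -{1}(divnK (dvd_deg (ltn_ord k))) mulnC exprM rhoX natrX.
Qed.

Definition combination m (c : nat -> rat) : {poly rat} :=
  \poly_(j < deg m) (c j / (content m j)%:R).

Lemma horner_combination m c x :
  (map_poly ratr (combination m c)).[x * theta rho m] =
  \sum_(j < deg m) ratr (c j) * x ^+ j * mono rho m j.
Proof.
rewrite /combination poly_def rmorph_sum horner_sum; apply: eq_bigr => j _.
rewrite /= map_polyZ map_polyXn hornerZ hornerXn exprMn thetaX fmorph_div /= ratr_nat.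
have : (content m j)%:R != 0 :> F by rewrite pnatr_eq0 -lt0n content_gt0.
by move=> ?; field.
Qed.
End Monomials.

Section AlgebraicNumbers.
Variable pi : nat -> algC.
Hypothesis piX : forall k, pi k ^+ d k = (n k)%:R.
Local Notation th := (theta pi).

(** Irreducibility of [X ^ deg m - radicand m].  All its complex roots have the
    same absolute value, so the constant term of a factor of degree [r] is a
    rational number [c] with [|c| ^ deg m = radicand m ^ r].  Comparing
    valuations at a prime factor of [n k], which divides [n k] exactly once and
    no other radicand, shows that [d k] divides [r], for each [k < m]. *)
Lemma minQpoly_theta m :
  minQpoly (th m) = 'X^(deg m) - (radicand m)%:R%:P.
Proof.
set q := _ - _; set p := minQpoly _; set D := deg m.
have D_gt0 : (0 < D)%N := deg_gt0 m.
have q_monic : q \is monic by rewrite monicXnsubC.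
have p_monic : p \is monic := minQpoly_monic _.
have rootq (z : algC) : root (map_poly ratr q) z = (z ^+ D == (radicand m)%:R).
  rewrite rmorphB /= map_polyXn map_polyC /= ratr_nat.
  by rewrite rootE !hornerE subr_eq0.
have pq : p %| q by rewrite -root_minQpoly_dvd rootq theta_deg.
pose P : {poly algC} := map_poly ratr p.
have P_monic : P \is monic by rewrite map_monic.
have [s] := closed_field_poly_normal P; rewrite (monicP P_monic) scale1r => PE.
have size_p : size p = (size s).+1.
  by rewrite -(size_map_poly (ratr : {rmorphism rat -> algC})) -/P PE size_prod_XsubC.
have normP : `|ratr p.[0] : algC| ^+ D = (radicand m)%:R ^+ size s.
  rewrite -horner_map rmorph0 -/P PE horner_prod.
  have rootP z : z \in s -> `|z| ^+ D = (radicand m)%:R.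
    rewrite -root_prod_XsubC -PE => Pz; rewrite -normrX.
    suff /eqP -> : z ^+ D == (radicand m)%:R by rewrite normr_nat.
    by rewrite -rootq; apply: root_dvdp Pz; rewrite dvdp_map.
  elim: (s) rootP => [|z s' IH] zP; first by rewrite big_nil normr1 expr1n.
  rewrite big_cons normrM exprMn !hornerE normrN exprS zP ?mem_head //.
  by rewrite IH // => y ys'; rewrite zP // in_cons ys' orbT.
have N_neq0 : (radicand m)%:R != 0 :> algC by rewrite pnatr_eq0 -lt0n radicand_gt0.
have s_neq0 : size s != 0%N.
  by have := size_minCpoly (th m); rewrite minQpolyE size_map_poly size_p; case: size.
have p0_neq0 : p.[0] != 0.
  apply: contraTneq (expf_neq0 (size s) N_neq0) => p0.
  by rewrite -normP p0 rmorph0 normr0 expr0n eqn0Ngt D_gt0 eqxx.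
have [a [b [a_gt0 b_gt0 abE]]] :
    exists a b, [/\ (0 < a)%N, (0 < b)%N & a ^ D = b ^ D * radicand m ^ size s]%N.
  apply: rat_pow_eq p0_neq0 _; apply: (fmorph_inj (ratr : {rmorphism rat -> algC})).
  by rewrite !rmorphXn /= ratr_nat -normP ratr_norm.
have D_dvd : (D %| size s)%N.
  apply: deg_dvd => k km; pose l := pdiv (n k).
  have l_pr : prime l := pdiv_prime (rs_gt1 sys k).
  have := congr1 (logn l) abE.
  rewrite lognM ?expn_gt0 ?b_gt0 ?radicand_gt0 // !lognX.
  rewrite (logn_prod_expn (fun i => deg m %/ d i)%N km l_pr (pdiv_dvd _)).
  have := divnK (dvd_deg km); rewrite -/D.
  have : (0 < D %/ d k)%N by rewrite divn_gt0 // dvdn_leq // dvd_deg.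
  move: (D %/ d k)%N => e e_gt0 <-; rewrite (mulnC e) -!mulnA.
  rewrite ![(d k * _)%N]mulnC (mulnC (size s)) -!mulnA => /eqP.
  rewrite -mulnDr eqn_pmul2l // => /eqP h.
  by rewrite -(dvdn_addr _ (dvdn_mull (logn l b) (dvdnn (d k)))) -h dvdn_mull.
have size_q : size q = D.+1 by rewrite size_XnsubC.
apply/eqP; rewrite -eqp_monic // -dvdp_size_eqp // size_q size_p eqSS.
rewrite eqn_leq (dvdn_leq _ D_dvd) ?lt0n // andbT -ltnS -size_p -size_q.
by rewrite dvdp_leq // monic_neq0.
Qed.

(** The minimal polynomial of [g(theta)], composed with [g], vanishes at
    [theta], hence at all the roots of the minimal polynomial of [theta]. *)
Lemma root_conjugate (F : numClosedFieldType) (z : F) (g : {poly rat}) m :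
  z ^+ deg m = (radicand m)%:R ->
  root (map_poly ratr (minQpoly (map_poly ratr g).[th m])) (map_poly ratr g).[z].
Proof.
move=> zX; set p := minQpoly _.
have : minQpoly (th m) %| p \Po g.
  rewrite -root_minQpoly_dvd map_comp_poly rootE horner_comp -rootE.
  by rewrite root_minQpoly_dvd.
rewrite minQpoly_theta -(dvdp_map (ratr : {rmorphism rat -> F})) /= => pg.
rewrite rootE -horner_comp -map_comp_poly -rootE; apply: root_dvdp pg _.
by rewrite rmorphB /= map_polyXn map_polyC /= ratr_nat rootE !hornerE zX subrr.
Qed.

Lemma root_conjugate_combination (F : numClosedFieldType) (rho : nat -> F) x m (c : nat -> rat) :
  (forall k, rho k ^+ d k = (n k)%:R) -> x ^+ deg m = 1 ->
  root (map_poly ratr (minQpoly (\sum_(j < deg m) ratr (c j) * mono pi m j)))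
    (\sum_(j < deg m) ratr (c j) * x ^+ j * mono rho m j).
Proof.
move=> rhoX x1; rewrite -(horner_combination rhoX m c x).
have -> : \sum_(j < deg m) ratr (c j) * mono pi m j = (map_poly ratr (combination m c)).[th m].
  rewrite -[th m]mul1r (horner_combination piX m c 1).
  by apply: eq_bigr => j _; rewrite expr1n mulr1.
by apply: root_conjugate; rewrite exprMn x1 mul1r theta_deg.
Qed.

Lemma pi_Aint k : pi k \in Aint.
Proof. exact: Aint_expr_nat (d_gt0 k) (piX k). Qed.

Lemma mono_Aint m j : mono pi m j \in Aint.
Proof. by apply: rpred_prod => k _; rewrite rpredX // pi_Aint. Qed.

(** The trace down to the field generated by [theta ^ e] is the sum over the
    conjugations [theta |-> z ^ i * theta], for [z] of order [e].  Applied to the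
    quotient by [theta ^ j0], which is then multiplied back, it extracts the
    monomials whose index is [j0] modulo [e]. *)
Lemma Aint_average m (c : nat -> rat) e j0 : (e %| deg m)%N ->
  \sum_(j < deg m) ratr (c j) * mono pi m j \in Aint ->
  e%:R * \sum_(j < deg m | j == j0 %[mod e]) ratr (c j) * mono pi m j \in Aint.
Proof.
move=> e_dvd cA; have e_gt0 := dvdn_gt0 (deg_gt0 m) e_dvd.
have [z z_prim] := C_prim_root_exists e_gt0.
have zA : z \in Aint := Aint_prim_root z_prim.
have -> : e%:R * \sum_(j < deg m | j == j0 %[mod e]) ratr (c j) * mono pi m j =
  \sum_(i < e) (z ^+ i ^- j0) * \sum_(j < deg m) ratr (c j) * (z ^+ i) ^+ j * mono pi m j.
  rewrite mulr_sumr big_mkcond /=.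
  under [RHS]eq_bigr do rewrite mulr_sumr.
  rewrite exchange_big /=; apply: eq_bigr => j _.
  transitivity (\sum_(i < e) (z ^+ j / z ^+ j0) ^+ i * (ratr (c j) * mono pi m j)).
    rewrite -mulr_suml (sum_prim_root_expr _ _ z_prim).
    by case: ifP => _; rewrite ?mul1r ?mul0r.
  apply: eq_bigr => i _; rewrite expr_div_n -!exprM (mulnC j) (mulnC j0) !exprM.
  by move: (_ ^- _) => u; ring.
apply: rpred_sum => i _.
have ze : (z ^+ i) ^+ e = 1 by rewrite exprAC (prim_expr_order z_prim) expr1n.
apply: rpredM.
  apply: (@Aint_unity_root e); rewrite //; apply/unity_rootP.
  by rewrite exprVn -[_ ^+ j0 ^+ e]exprM mulnC exprM ze expr1n invr1.
have x1 : (z ^+ i) ^+ deg m = 1.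
  by rewrite -(divnK e_dvd) mulnC exprM ze expr1n.
have := root_conjugate_combination c piX x1; rewrite -minQpolyE => h.
apply: root_monic_Aint h (minCpoly_monic _) _.
exact: cA.
Qed.

(** Integrality of [y / q] may be tested after multiplication by an integer prime
    to [q] (Bezout). *)
Lemma Aint_coprime_divr (q u : nat) (y : algC) : (0 < q)%N -> coprime q u ->
  y \in Aint -> u%:R * (y / q%:R) \in Aint -> y / q%:R \in Aint.
Proof.
move=> q_gt0 qu yA uA; have q0 : q%:R != 0 :> algC by rewrite pnatr_eq0 -lt0n.
have [u0|u_gt0] := posnP u.
  by move: qu; rewrite u0 /coprime gcdn0 => /eqP ->; rewrite divr1.
have /(coprimeP _ u_gt0) [[a b] /= abE] : coprime u q by rewrite coprime_sym.
have abE' : a%:R * u%:R = 1 + b%:R * q%:R :> algC.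
  by rewrite -!natrM nat1r -add1n -abE subnK // ltnW // -subn_gt0 abE.
have -> : y / q%:R = a%:R * (u%:R * (y / q%:R)) - b%:R * y.
  rewrite mulrA abE'; field; exact: q0.
by rewrite rpredB // rpredM // rpred_nat.
Qed.

Lemma eqn_mod_deg m i j : (i < deg m)%N -> (j < deg m)%N ->
  (forall k, (k < m)%N -> i = j %[mod d k]) -> i = j.
Proof.
move=> lt_i lt_j; wlog le_ij : i j lt_i lt_j / (i <= j)%N => [W h|h].
  by case/orP: (leq_total i j) => ?; [|symmetry]; apply: W => // k /h.
suff : (deg m %| j - i)%N.
  have [lt_ij|ge_ij _] := ltnP i j; last by apply/eqP; rewrite eqn_leq le_ij.
  rewrite gtnNdvd ?subn_gt0 //; apply: leq_ltn_trans lt_j; exact: leq_subr.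
by apply: deg_dvd => k /h /esym/eqP; rewrite eqn_mod_dvd.
Qed.

(** At a prime [q] that is not a [d k], the full trace isolates a single
    [b j * mono j / q].  The power [deg m] of this algebraic integer is rational,
    so [q ^ deg m] divides [b j ^ deg m * W] for an integer [W] in which [q] occurs
    with an exponent less than [deg m], because the radicands are squarefree
    and pairwise coprime, and the exponent of [pi k] in the monomial is less than
    [d k]. *)
Lemma dvdz_combination_tame (q : nat) m (b : nat -> int) : prime q ->
  (forall k, (k < m)%N -> d k != q) ->
  (\sum_(j < deg m) (b j)%:~R * mono pi m j) / q%:R \in Aint ->
  forall j, (j < deg m)%N -> (q %| b j)%Z.
Proof.
move=> q_pr dq bA j lt_j; have q_gt0 := prime_gt0 q_pr.
pose D := deg m; have D_gt0 : (0 < D)%N := deg_gt0 m.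
have bqA : (b j)%:~R * mono pi m j / q%:R \in Aint.
  apply: (@Aint_coprime_divr q D) => //.
  - rewrite /D /deg; elim/big_rec: _ => [|i x _ cx]; first exact: coprimen1.
    rewrite coprimeMr cx andbT coprime_sym prime_coprime // dvdn_prime2 //.
    exact: dq.
  - by rewrite rpredM ?mono_Aint ?Aint_int.
  have H : \sum_(i < D) ratr ((b i)%:~R / q%:R) * mono pi m i \in Aint.
    rewrite (eq_bigr (fun i : 'I_D => (b i)%:~R * mono pi m i / q%:R)).
      by rewrite -mulr_suml.
    by move=> i _; rewrite fmorph_div /= ratr_int ratr_nat mulrAC.
  have := @Aint_average m (fun i => (b i)%:~R / q%:R) D j (dvdnn _) H.
  rewrite (bigD1 (Ordinal lt_j)) /= ?eqxx // big1 ?addr0; last first.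
    move=> i /andP[]; rewrite !modn_small // => /eqP ij.
    by rewrite -val_eqE /= ij eqxx.
  by rewrite fmorph_div /= ratr_int ratr_nat mulrAC.
pose e k := ((j %% d k) * (D %/ d k))%N.
have monoX : mono pi m j ^+ D = (\prod_(k < m) n k ^ e k)%N%:R.
  rewrite /mono -prodrXl natr_prod; apply: eq_bigr => k _.
  have kD := divnK (dvd_deg (ltn_ord k)); rewrite -/D in kD.
  by rewrite natrX -piX -!exprM -[in LHS]kD mulnA mulnC.
move: (rpredX D bqA); rewrite !exprMn monoX exprVn -natrX -rmorphXn /=.
rewrite pmulrn -intrM Aint_divz ?expn_gt0 ?q_gt0 //.
rewrite !dvdzE abszM abszX /= => qD.
have [//|qb] := boolP (q %| `|b j|)%N; exfalso.
move: qD; rewrite Gauss_dvdr ?coprimeXl ?coprimeXr ?prime_coprime //.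
have W_gt0 : (0 < \prod_(k < m) n k ^ e k)%N.
  by apply: prodn_gt0 => k; rewrite expn_gt0 n_gt0.
rewrite pfactor_dvdn // leqNgt => /negP; apply.
case: (boolP [exists k : 'I_m, q %| n k]%N) => [/existsP[k qn]|].
  rewrite (logn_prod_expn e (ltn_ord k) q_pr qn) /e.
  rewrite -[ltnRHS](divnK (dvd_deg (ltn_ord k))) mulnC ltn_pmul2l ?ltn_pmod //.
  by rewrite divn_gt0 // dvdn_leq // dvd_deg.
move=> /existsPn qn; rewrite logn_coprime //.
elim/big_rec: _ => [|i x _ cx]; first exact: coprimen1.
by rewrite coprimeMr cx andbT coprimeXr // prime_coprime.
Qed.

(** At [q = d k], a trace over the other radicals, whose degree [e] is prime to
    [q], reduces to combinations of powers of [pi k] alone, to which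
    [eisenstein_dvdz] applies.  The monomial [nu] in the other radicals is
    removed by multiplying with [nu ^ (e - 1)], as [nu ^ e] is an integer
    prime to [q]. *)
Lemma dvdz_combination_wild k m (b : nat -> int) : (k < m)%N ->
  (\sum_(j < deg m) (b j)%:~R * mono pi m j) / (d k)%:R \in Aint ->
  forall j, (j < deg m)%N -> (d k %| b j)%Z.
Proof.
move=> km; set q := d k; have q_pr : prime q := d_pr k.
have q_gt0 := prime_gt0 q_pr.
pose D := deg m; have D_gt0 : (0 < D)%N := deg_gt0 m.
move=> bA j0 lt_j0; pose ik := Ordinal km.
pose e := (\prod_(i < m | i != ik) d i)%N.
have DE : D = (q * e)%N by rewrite /D /deg (bigD1 ik).
have e_gt0 : (0 < e)%N by rewrite /e prodn_cond_gt0.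
have dvd_e (i : 'I_m) : i != ik -> (d i %| e)%N.
  by move=> ine; rewrite /e (bigD1 i) //= dvdn_mulr.
have qe : coprime q e.
  rewrite /e; elim/big_rec: _ => [|i x ine cx]; first exact: coprimen1.
  rewrite coprimeMr cx andbT; apply: rs_coprime_dd sys _ _ _.
  by rewrite eq_sym -val_eqE in ine.
pose nu := \prod_(i < m | i != ik) pi i ^+ (j0 %% d i).
have monoE j : j = j0 %[mod e] -> mono pi m j = pi k ^+ (j %% q) * nu.
  move=> jj0; rewrite /mono (bigD1 ik) //=; congr (_ * _).
  apply: eq_bigr => i ine; congr (_ ^+ _).
  by rewrite -(modn_dvdm j (dvd_e i ine)) jj0 modn_dvdm ?dvd_e.
have nuA : nu \in Aint by apply: rpred_prod => i _; rewrite rpredX // pi_Aint.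
pose V := (\prod_(i < m | i != ik) n i ^ ((j0 %% d i) * (e %/ d i)))%N.
have nuX : nu ^+ e = V%:R.
  rewrite /nu -prodrXl natr_prod; apply: eq_bigr => i ine.
  by rewrite natrX -piX -!exprM -[in LHS](divnK (dvd_e i ine)) mulnA mulnC.
have qV : coprime q V.
  rewrite /V; elim/big_rec: _ => [|i x _ cx]; first exact: coprimen1.
  by rewrite coprimeMr cx andbT coprimeXr // (rs_coprime_dn sys).
pose Z := \sum_(j < D | j == j0 %[mod e]) (b j)%:~R * pi k ^+ (j %% q).
have ZA : Z \in Aint.
  by apply: rpred_sum => i _; rewrite rpredM ?rpredX ?pi_Aint ?Aint_int.
have nuZE : \sum_(j < D | j == j0 %[mod e]) (b j)%:~R * mono pi m j = nu * Z.
  rewrite mulr_sumr; apply: eq_bigr => j /eqP/monoE ->.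
  by rewrite mulrA mulrC.
have nuZA : nu * Z / q%:R \in Aint.
  apply: (@Aint_coprime_divr q e) => //; first by rewrite rpredM.
  have H : \sum_(i < D) ratr ((b i)%:~R / q%:R) * mono pi m i \in Aint.
    rewrite (eq_bigr (fun i : 'I_D => (b i)%:~R * mono pi m i / q%:R)).
      by rewrite -mulr_suml.
    by move=> i _; rewrite fmorph_div /= ratr_int ratr_nat mulrAC.
  have e_dvd : (e %| deg m)%N by rewrite -/D DE dvdn_mull.
  have := @Aint_average m (fun i => (b i)%:~R / q%:R) e j0 e_dvd H.
  rewrite -nuZE mulr_suml (eq_bigr (fun i : 'I_D => (b i)%:~R * mono pi m i / q%:R)) //.
  by move=> i _; rewrite fmorph_div /= ratr_int ratr_nat mulrAC.
have ZqA : Z / q%:R \in Aint.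
  apply: (@Aint_coprime_divr q V) => //; rewrite -nuX -(prednK e_gt0) exprSr.
  by rewrite -mulrA (mulrA nu) rpredM // rpredX.
(* The sum has a single term, by the Chinese remainder theorem. *)
pose b' i := \sum_(j < D | (j == j0 %[mod e]) && (j %% q == i)%N) b j.
have ZE : Z = \sum_(i < q) (b' i)%:~R * pi k ^+ i.
  rewrite /Z (partition_big (fun j : 'I_D => Ordinal (ltn_pmod j q_gt0)) xpredT) //=.
  apply: eq_bigr => i _; rewrite /b' rmorph_sum /= mulr_suml.
  by apply: eq_big => [j|j /andP[_ /eqP <-]].
have := @eisenstein_dvdz q (n k) (pi k) q_pr (piX k) (rs_nonwief sys k) b'.
rewrite -ZE => /(_ ZqA _ (ltn_pmod j0 q_gt0)).
rewrite /b' (bigD1 (Ordinal lt_j0)) /=; last by rewrite !eqxx.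
rewrite big1 ?addr0 // => j /andP[/andP[/eqP je /eqP jq]].
case/negP; rewrite -val_eqE /=; apply/eqP.
apply: (@eqn_mod_deg m) => // i im; have [->//|ik_neq] := eqVneq i k.
have dvd_ie : (d i %| e)%N by apply: (dvd_e (Ordinal im)); rewrite -val_eqE.
by rewrite -(modn_dvdm j dvd_ie) je modn_dvdm.
Qed.

Lemma dvdz_combination (q : nat) m (b : nat -> int) : prime q ->
  (\sum_(j < deg m) (b j)%:~R * mono pi m j) / q%:R \in Aint ->
  forall j, (j < deg m)%N -> (q %| b j)%Z.
Proof.
move=> q_pr bA; case: (boolP [exists k : 'I_m, d k == q]).
  by case/existsP=> k /eqP kq; rewrite -kq in bA *; apply: dvdz_combination_wild bA.
move=> /existsPn h; apply: dvdz_combination_tame bA => // k km.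
exact: h (Ordinal km).
Qed.

(** The monomials form an integral basis: the prime factors of a common
    denominator [B] are removed one at a time by [dvdz_combination]. *)
Lemma Aint_combination m (c : nat -> rat) :
  \sum_(j < deg m) ratr (c j) * mono pi m j \in Aint ->
  exists b : nat -> int, forall j, (j < deg m)%N -> c j = (b j)%:~R.
Proof.
move=> cA.
suff main B (b : nat -> int) : (0 < B)%N ->
    (forall j, (j < deg m)%N -> c j = (b j)%:~R / B%:R) ->
    exists b : nat -> int, forall j, (j < deg m)%N -> c j = (b j)%:~R.
  pose B := (\prod_(j < deg m) `|denq (c j)|)%N.
  have B_gt0 : (0 < B)%N by apply: prodn_gt0 => j; rewrite absz_gt0 denq_neq0.
  have dvd_B j : (j < deg m)%N -> (`|denq (c j)| %| B)%N.
    by move=> lt_j; rewrite /B (bigD1 (Ordinal lt_j)) //= dvdn_mulr.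
  clearbody B.
  apply: (main B (fun j => numq (c j) * (B %/ `|denq (c j)|)%N%:Z)) => // j lt_j.
  have dE : `|denq (c j)|%N%:R = (denq (c j))%:~R :> rat by rewrite pmulrn absz_denq.
  have := divnK (dvd_B j lt_j); move: (B %/ _)%N => u BE.
  have : (0 < u)%N by move: B_gt0; rewrite -BE; case: u {BE}.
  rewrite -(ltr_nat rat) => /lt0r_neq0 u0.
  have v0 : (denq (c j))%:~R != 0 :> rat by rewrite intr_eq0 denq_neq0.
  rewrite -BE natrM dE intrM -pmulrn -[LHS]divq_num_den; field.
  by rewrite u0 v0.
elim/ltn_ind: B b => B IH b B_gt0 cE.
have [B1|B_gt1] := leqP B 1.
  by exists b => j /cE ->; rewrite (_ : B = 1%N) ?divr1 //; apply/eqP; rewrite eqn_leq B1.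
pose q := pdiv B; have q_pr : prime q := pdiv_prime B_gt1.
have /dvdnP[B' BE] := pdiv_dvd B; rewrite -/q in BE.
have q_gt0 := prime_gt0 q_pr.
have B'_gt0 : (0 < B')%N by move: B_gt0; rewrite BE; case: (B').
have q0 : q%:R != 0 :> algC by rewrite pnatr_eq0 -lt0n.
have B'0 : B'%:R != 0 :> algC by rewrite pnatr_eq0 -lt0n.
have q_dvd : forall j, (j < deg m)%N -> (q %| b j)%Z.
  apply: dvdz_combination => //.
  have -> : (\sum_(j < deg m) (b j)%:~R * mono pi m j) / q%:R =
     B'%:R * \sum_(j < deg m) ratr (c j) * mono pi m j.
    rewrite mulr_suml mulr_sumr; apply: eq_bigr => j _; rewrite cE // BE.
    rewrite fmorph_div /= ratr_int ratr_nat natrM; field.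
    by rewrite q0 B'0.
  by rewrite rpredM ?rpred_nat.
apply: (IH B' _ (fun j => (b j %/ q%:Z)%Z)) => // [|j lt_j].
  by rewrite BE ltn_Pmulr // prime_gt1.
rewrite cE // -{1}(divzK (q_dvd j lt_j)) BE natrM intrM -pmulrn.
field; rewrite !pnatr_eq0 -!lt0n q_gt0 B'_gt0 //.
Qed.
End AlgebraicNumbers.
End RadicalTower.

(** * A Parseval inequality for the house *)

Lemma exists_prim_root (F : numClosedFieldType) e :
  (0 < e)%N -> exists z : F, e.-primitive_root z.
Proof.
move=> e_gt0; pose p : {poly F} := 'X^e - 1.
have [r pE] := closed_field_poly_normal p.
rewrite (monicP _) ?monicXnsubC // scale1r in pE.
have r1 : all e.-unity_root r by apply/allP=> z; rewrite -root_prod_XsubC -pE.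
have sz_r : (e < (size r).+1)%N.
  by rewrite -(size_prod_XsubC r id) -pE size_XnsubC.
have [|z] := hasP (has_prim_root e_gt0 r1 _ sz_r); last by exists z.
by rewrite -separable_prod_XsubC -pE separable_Xn_sub_1 // pnatr_eq0 -lt0n.
Qed.

(** The coefficients being real, the cross terms of the left-hand side are the
    [a j * a k] times powers of [z ^ j / z ^ k], whose sum over [i] vanishes. *)
Lemma parseval (F : numClosedFieldType) e (z : F) (a : nat -> F) :
  e.-primitive_root z -> (forall j, a j \is Num.real) ->
  \sum_(i < e) `|\sum_(j < e) a j * (z ^+ i) ^+ j| ^+ 2 =
  e%:R * \sum_(j < e) a j ^+ 2.
Proof.
move=> z_prim a_real; have e_gt0 := prim_order_gt0 z_prim.
have z_norm : `|z| = 1.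
  apply/eqP; rewrite -(pexpr_eq1 (n := e)) //.
  by rewrite -normrX (prim_expr_order z_prim) normr1.
have z_conj : z^* = z^-1 by rewrite invC_norm z_norm expr1n invr1 mul1r.
transitivity (\sum_(i < e) \sum_(j < e) \sum_(k < e)
    (z ^+ j / z ^+ k) ^+ i * (a j * a k)).
  apply: eq_bigr => i _; rewrite normCK rmorph_sum mulr_suml.
  apply: eq_bigr => j _; rewrite mulr_sumr; apply: eq_bigr => k _.
  rewrite rmorphM !rmorphXn /= z_conj (CrealP (a_real k)).
  by rewrite expr_div_n (exprAC z j) (exprAC z k) !exprVn; ring.
rewrite exchange_big mulr_sumr /=; apply: eq_bigr => j _.
rewrite exchange_big (bigD1 j) //= [X in _ + X]big1 ?addr0 => [|k kj].
  by rewrite -mulr_suml (sum_prim_root_expr _ _ z_prim) eqxx mul1r.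
rewrite -mulr_suml (sum_prim_root_expr _ _ z_prim) !modn_small //.
by rewrite eq_sym val_eqE (negPf kj) !mul0r.
Qed.

Section House.
Variable R : realType.
Local Open Scope complex_scope.
Local Notation normc := ComplexField.Normc.normc.

Lemma normcE (z : R[i]) : `|z| = (normc z)%:C.
Proof. by case: z. Qed.

Lemma normcX (z : R[i]) e : normc (z ^+ e) = normc z ^+ e.
Proof. by apply: complexI; rewrite rmorphXn /= -!normcE normrX. Qed.

Lemma normc_nat N : normc (N%:R : R[i]) = N%:R.
Proof. by apply: complexI; rewrite -normcE rmorph_nat normr_nat. Qed.

Lemma normc_ge0 (z : R[i]) : 0 <= normc z.
Proof. by rewrite -lecR -normcE rmorph0. Qed.

Lemma house_ge0 a : 0 <= house R a.
Proof. exact: bigmax_ge_id. Qed.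

Lemma normc_le_house a (z : R[i]) :
  root (map_poly ratr (minQpoly a)) z -> normc z <= house R a.
Proof. by rewrite -mem_conjugates => za; apply: le_bigmax_seq za _. Qed.

(** All the conjugates of such an [a] are roots of [X ^ e - N], so they have the
    same absolute value. *)
Lemma house_root (a : algC) (r : R) e N : (0 < e)%N -> 0 <= r ->
  a ^+ e = N%:R -> r ^+ e = N%:R -> house R a = r.
Proof.
move=> e_gt0 r_ge0 aX rX.
have zr z : root (map_poly ratr (minQpoly a)) z -> normc z = r.
  move=> za; apply/eqP; rewrite -(eqrXn2 e_gt0) ?normc_ge0 // -normcX rX.
  suff /eqP -> : z ^+ e == N%:R by rewrite normc_nat.
  have : root (map_poly ratr ('X^e - N%:R%:P : {poly rat})) z.
    apply: root_dvdp za; rewrite dvdp_map -root_minQpoly_dvd.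
    by rewrite rmorphB /= map_polyXn map_polyC /= ratr_nat rootE !hornerE aX subrr.
  by rewrite rmorphB /= map_polyXn map_polyC /= ratr_nat rootE !hornerE subr_eq0.
apply/le_anti/andP; split.
  rewrite /house big_seq; apply: bigmax_le => // z.
  by rewrite mem_conjugates => /zr ->.
have [|z za] := closed_rootP (map_poly ratr (minQpoly a) : {poly R[i]}) _.
  rewrite size_map_poly -(size_map_poly (ratr : {rmorphism rat -> algC})).
  by rewrite -minQpolyE gtn_eqF // size_minCpoly.
by rewrite -(zr z za); apply: normc_le_house.
Qed.

Section Parseval.
Variables d n : nat -> nat.
Hypothesis sys : radical_system d n.
Variables (pi : nat -> algC) (varpi : nat -> R).
Hypothesis piX : forall k, pi k ^+ d k = (n k)%:R.
Hypothesis varpiX : forall k, varpi k ^+ d k = (n k)%:R.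

(** The left-hand side is the mean of the squared absolute values of those
    conjugates of the combination that come from the conjugates of [theta]. *)
Lemma parseval_house m (c : nat -> rat) :
  \sum_(j < deg d m) (ratr (c j) * mono d varpi m j) ^+ 2 <=
  house R (\sum_(j < deg d m) ratr (c j) * mono d pi m j) ^+ 2.
Proof.
set D := deg d m; set h := house R _.
have D_gt0 : (0 < D)%N := deg_gt0 sys m.
have [z z_prim] := exists_prim_root R[i] D_gt0.
pose a j : R[i] := (ratr (c j) * mono d varpi m j)%:C.
have a_real j : a j \is Num.real.
  by rewrite complex_real.
have sumE : (\sum_(j < D) (ratr (c j) * mono d varpi m j) ^+ 2)%:C =
    \sum_(j < D) a j ^+ 2 :> R[i].
  by rewrite rmorph_sum; apply: eq_bigr => j _; rewrite /= rmorphXn.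
rewrite -(ler_pM2l (_ : 0 < D%:R)) ?ltr0n // -lecR 2!rmorphM /= sumE.
rewrite !rmorph_nat -(parseval z_prim a_real) rmorphXn /=.
apply: le_trans (_ : \sum_(i < D) h%:C ^+ 2 <= _); last first.
  by rewrite sumr_const card_ord mulr_natl.
apply: ler_sum => i _; rewrite normcE -!rmorphXn /= lecR.
rewrite lerXn2r ?nnegrE ?normc_ge0 ?house_ge0 // /h.
apply: normc_le_house.
have rhoX k : (varpi k)%:C ^+ d k = (n k)%:R by rewrite -rmorphXn varpiX rmorph_nat.
have x1 : (z ^+ i) ^+ D = 1 by rewrite exprAC (prim_expr_order z_prim) expr1n.
have := root_conjugate_combination sys piX c rhoX x1.
congr (root _ _); apply: eq_bigr => j _; rewrite /a rmorphM /=.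
have -> : (mono d varpi m j)%:C = mono d (fun k => (varpi k)%:C) m j.
  by rewrite /mono rmorph_prod; apply: eq_bigr => k _; rewrite rmorphXn.
have -> : (ratr (c j) : R)%:C = ratr (c j) by rewrite fmorph_rat.
by rewrite mulrAC.
Qed.
End Parseval.
End House.

(** * The infinite radical tower and its small integers *)

Section Tower.
Variables d n : nat -> nat.
Hypothesis sys : radical_system d n.

Definition radical k : algC := (d k).-root (n k)%:R.
(** [level m] is the field generated by the first [m] radicals, presented as
    the polynomials in their product. *)
Definition level m : {pred algC} :=
  fun a => `[< exists g : {poly rat}, a = (map_poly ratr g).[theta radical m] >].
Definition tower : {pred algC} := fun a => `[< exists m, a \in level m >].

Lemma radicalX k : radical k ^+ d k = (n k)%:R.
Proof. by rewrite rootCK // prime_gt0 // (rs_prime sys). Qed.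

Lemma levelP m a :
  reflect (exists g : {poly rat}, a = (map_poly ratr g).[theta radical m]) (a \in level m).
Proof. exact: asboolP. Qed.

Lemma towerP a : reflect (exists m, a \in level m) (a \in tower).
Proof. exact: asboolP. Qed.

Lemma level_rat m q : ratr q \in level m.
Proof. by apply/levelP; exists q%:P; rewrite map_polyC hornerC. Qed.

Lemma level0 m : 0 \in level m.
Proof. by rewrite -(rmorph0 (ratr : {rmorphism rat -> algC})) level_rat. Qed.

Lemma level1 m : 1 \in level m.
Proof. by rewrite -(rmorph1 (ratr : {rmorphism rat -> algC})) level_rat. Qed.

Lemma levelB m : {in level m &, forall a b, a - b \in level m}.
Proof.
move=> _ _ /levelP[g ->] /levelP[h ->]; apply/levelP; exists (g - h).
by rewrite rmorphB !hornerE.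
Qed.

Lemma levelD m : {in level m &, forall a b, a + b \in level m}.
Proof.
move=> _ _ /levelP[g ->] /levelP[h ->]; apply/levelP; exists (g + h).
by rewrite rmorphD !hornerE.
Qed.

Lemma levelM m : {in level m &, forall a b, a * b \in level m}.
Proof.
move=> _ _ /levelP[g ->] /levelP[h ->]; apply/levelP; exists (g * h).
by rewrite rmorphM !hornerE.
Qed.

Lemma levelX m e : {in level m, forall a, a ^+ e \in level m}.
Proof.
move=> a aL; elim: e => [|e IH]; last by rewrite exprS levelM.
by rewrite expr0 level1.
Qed.

Lemma level_horner m a (g : {poly rat}) :
  a \in level m -> (map_poly ratr g).[a] \in level m.
Proof.
case/levelP=> h ->; apply/levelP; exists (g \Po h).
by rewrite map_comp_poly horner_comp.
Qed.

(** If [p * 'X + c] is the minimal polynomial of [a <> 0], then [c <> 0] and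
    [- p.[a] / c] is the inverse of [a]. *)
Lemma levelV m : {in level m, forall a, a^-1 \in level m}.
Proof.
move=> a aL; have [->|a0] := eqVneq a 0.
  by rewrite invr0 level0.
have [p [c pE]] : exists p c, minQpoly a = p * 'X + c%:P.
  elim/poly_ind: (minQpoly a) => [|p c _]; last by exists p, c.
  by exists 0, 0; rewrite mul0r add0r polyC0.
have pa : (map_poly ratr p).[a] * a = - ratr c.
  have /rootP := root_minCpoly a; rewrite minQpolyE pE.
  rewrite rmorphD rmorphM /= map_polyX map_polyC /= !hornerE => /eqP.
  by rewrite addr_eq0 => /eqP.
have c0 : c != 0.
  apply/eqP => c0; rewrite c0 polyC0 addr0 in pE.
  have p0 : p != 0.
    by have := monic_neq0 (minQpoly_monic a); rewrite pE; apply: contraNneq => ->; rewrite mul0r.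
  move/eqP: pa; rewrite c0 rmorph0 oppr0 mulf_eq0 (negPf a0) orbF => /eqP pa.
  have : minQpoly a %| p by rewrite -root_minQpoly_dvd; apply/rootP.
  by move/(dvdp_leq p0); rewrite pE size_mulX // ltnn.
have -> : a^-1 = ratr (- c^-1) * (map_poly ratr p).[a].
  apply: (mulIf a0); rewrite mulVf // -mulrA pa rmorphN fmorphV mulrNN mulVf //.
  by rewrite fmorph_eq0.
by rewrite levelM ?level_rat ?level_horner.
Qed.

(** [radical k] is a rational multiple of the power [j] of the product, for an
    exponent [j] that is 1 modulo [d k] and 0 modulo the other [d i]. *)
Lemma radical_level m k : (k < m)%N -> radical k \in level m.
Proof.
move=> km; pose ik := Ordinal km.
pose e := (\prod_(i < m | i != ik) d i)%N.
have ke : coprime (d k) e.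
  rewrite /e; elim/big_rec: _ => [|i x ine cx]; first exact: coprimen1.
  rewrite coprimeMr cx andbT; apply: rs_coprime_dd sys _ _ _.
  by rewrite eq_sym -val_eqE in ine.
pose j := chinese (d k) e 1 0.
have jk : (j %% d k = 1)%N.
  by rewrite /j chinese_modl // modn_small // prime_gt1 // (rs_prime sys).
have je (i : 'I_m) : i != ik -> (j %% d i = 0)%N.
  move=> ine; apply/eqP; rewrite -/(dvdn _ _).
  apply: (@dvdn_trans e); first by rewrite /e (bigD1 i) //= dvdn_mulr.
  by apply/eqP; rewrite /j chinese_modr // mod0n.
have monoE : mono d radical m j = radical k.
  rewrite /mono (bigD1 ik) //= jk expr1 big1 ?mulr1 // => i /je ->.
  by rewrite expr0.
have c0 : (content d n m j)%:R != 0 :> algC.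
  by rewrite pnatr_eq0 -lt0n (content_gt0 sys).
apply/levelP; exists (((content d n m j)%:R)^-1 *: 'X^j).
rewrite map_polyZ map_polyXn hornerZ hornerXn (thetaX radicalX) monoE.
by rewrite fmorphV /= ratr_nat mulKf.
Qed.

Lemma level_le m m' a : (m <= m')%N -> a \in level m -> a \in level m'.
Proof.
move=> le_m /levelP[g ->]; apply: level_horner; rewrite /theta.
elim/big_rec: _ => [|k x _ xL].
  exact: level1.
by rewrite levelM // radical_level // (leq_trans (ltn_ord k)).
Qed.

Lemma tower_subfield : subfield_of_algC tower.
Proof.
split.
- apply/towerP; exists 0%N; exact: level1.
- move=> a b /towerP[m am] /towerP[m' bm]; apply/towerP; exists (maxn m m').
  by apply: levelB; [apply: level_le am|apply: level_le bm]; rewrite ?leq_maxl ?leq_maxr.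
- move=> a b /towerP[m am] /towerP[m' bm]; apply/towerP; exists (maxn m m').
  apply: levelM; first by apply: level_le am; apply: leq_maxl.
  by apply: levelV; apply: level_le bm; apply: leq_maxr.
Qed.

Definition integral_combination m (b : nat -> int) :=
  \sum_(j < deg d m) (b j)%:~R * mono d radical m j.

Lemma integer_level m a : a \in level m -> a \in Aint ->
  exists b, a = integral_combination m b.
Proof.
move=> /levelP[g ->] aA; pose D := deg d m.
pose f : {poly rat} := 'X^D - (radicand d n m)%:R%:P.
have f_monic : f \is monic by rewrite monicXnsubC // (deg_gt0 sys).
have size_f : size f = D.+1 by rewrite size_XnsubC // (deg_gt0 sys).
pose c j := (g %% f)`_j * (content d n m j)%:R.
have gE : (map_poly ratr g).[theta radical m] =
    \sum_(j < deg d m) ratr (c j) * mono d radical m j.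
  rewrite {1}(divp_eq g f) rmorphD rmorphM /= hornerD hornerM.
  have -> : (map_poly ratr f).[theta radical m] = 0.
    rewrite rmorphB /= map_polyXn map_polyC /= ratr_nat !hornerE.
    by rewrite (theta_deg radicalX) subrr.
  rewrite mulr0 add0r (@horner_coef_wide _ D); last first.
    by rewrite size_map_poly -ltnS -size_f ltn_modp monic_neq0.
  apply: eq_bigr => j _; rewrite coef_map /= (thetaX radicalX) /c rmorphM /= ratr_nat.
  by rewrite mulrA.
rewrite gE in aA *; have [b bE] := Aint_combination sys radicalX aA.
by exists b; apply: eq_bigr => j _; rewrite bE // ratr_int.
Qed.

Lemma integral_combination_level m k0 (b : nat -> int) :
  (forall j k, (j < deg d m)%N -> b j != 0 -> (k0 <= k < m)%N -> j %% d k = 0)%N ->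
  integral_combination m b \in level k0.
Proof.
move=> supp; rewrite /integral_combination.
elim/big_rec: _ => [|j x _ xL].
  exact: level0.
rewrite levelD //; have [->|bj] := eqVneq (b j) 0.
  by rewrite mul0r level0.
rewrite levelM //; first by rewrite -ratr_int level_rat.
rewrite /mono; elim/big_rec: _ => [|k y _ yL].
  exact: level1.
rewrite levelM //; have [k_lt|k_ge] := ltnP k k0.
  by rewrite levelX // radical_level.
rewrite (supp j k) ?k_ge ?ltn_ord // expr0.
exact: level1.
Qed.

(** A coincidence of two radicals would give
    [n i ^ d j = n j ^ d i] with coprime radicands. *)
Lemma radical_inj : injective radical.
Proof.
move=> i j ij; apply/eqP/negPn/negP => ne_ij.
have /eqP : (n i ^ d j)%:R = (n j ^ d i)%:R :> algC.
  by rewrite !natrX -!radicalX ij exprAC.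
rewrite eqr_nat => /eqP nE.
have : coprime (n i ^ d j) (n j ^ d i).
  by rewrite coprimeXl // coprimeXr // (rs_coprime_nn sys).
rewrite -nE /coprime gcdnn => /eqP n1; have := rs_gt1 sys i.
rewrite -(ltn_exp2r _ _ (prime_gt0 (rs_prime sys j))) exp1n.
by rewrite n1.
Qed.

Lemma radical_Aint k : radical k \in Aint.
Proof. exact: (pi_Aint sys radicalX k). Qed.

Lemma radical_integers k : ring_of_integers tower (radical k).
Proof.
split; last exact: radical_Aint.
by apply/towerP; exists k.+1; apply: radical_level.
Qed.

Section Houses.
(* The radicals once more, as elements of [R]: absolute values are compared
   there, whereas [radical k] lives in [algC]. *)
Variables (R : realType) (varpi : nat -> R).
Hypothesis varpiX : forall k, varpi k ^+ d k = (n k)%:R.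
Hypothesis varpi_ge1 : forall k, 1 <= varpi k.

Lemma house_radical k : house R (radical k) = varpi k.
Proof.
apply: house_root (radicalX k) (varpiX k); first by rewrite prime_gt0 // (rs_prime sys).
exact: le_trans (varpi_ge1 k).
Qed.

Lemma house_radicalN k : house R (- radical k) = varpi k.
Proof.
apply: (@house_root _ _ _ (d k * 2) (n k ^ 2)).
- by rewrite muln_gt0 prime_gt0 // (rs_prime sys).
- exact: le_trans (varpi_ge1 k).
- by rewrite mulnC exprM sqrrN -exprM mulnC exprM radicalX natrX.
- by rewrite exprM varpiX natrX.
Qed.

Lemma mono_ge1 m j : 1 <= mono d varpi m j.
Proof.
by rewrite /mono; elim/big_rec: _ => // k x _ x1; rewrite mulr_ege1 // exprn_ege1.
Qed.

(** The bound on the cofactor [x] serves to exclude monomials in two distinct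
    radicals. *)
Lemma mono_split m j k : (k < m)%N -> exists2 x, mono d varpi m j = varpi k ^+ (j %% d k) * x &
  1 <= x /\ forall l, (l < m)%N -> l != k -> (j %% d l != 0)%N -> varpi l <= x.
Proof.
move=> km; rewrite /mono (bigD1 (Ordinal km)) //=; eexists; first by [].
split; first by elim/big_rec: _ => // i x _ x1; rewrite mulr_ege1 // exprn_ege1.
move=> l lm lk jl; rewrite (bigD1 (Ordinal lm)) //=.
rewrite -[leLHS]mulr1 ler_pM //; first exact: le_trans (varpi_ge1 l).
  by rewrite -[leLHS]expr1 ler_weXn2l // lt0n.
by elim/big_rec: _ => // i x _ x1; rewrite mulr_ege1 // exprn_ege1.
Qed.

Lemma varpi_le_mono m j k : (k < m)%N -> (j %% d k != 0)%N ->
  varpi k <= mono d varpi m j.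
Proof.
move=> km jk; have [x -> [x1 _]] := mono_split j km.
rewrite -[leLHS]mulr1 ler_pM //; first exact: le_trans (varpi_ge1 k).
by rewrite -[leLHS]expr1 ler_weXn2l // lt0n.
Qed.

Lemma sum_le_house m (b : nat -> int) :
  \sum_(j < deg d m) (b j)%:~R ^+ 2 * mono d varpi m j ^+ 2 <=
  house R (integral_combination m b) ^+ 2.
Proof.
have := parseval_house sys radicalX varpiX m (fun j => (b j)%:~R).
rewrite (eq_bigr (fun j : 'I__ => (b j)%:~R ^+ 2 * mono d varpi m j ^+ 2)).
  move=> /le_trans; apply; rewrite /integral_combination.
  by under eq_bigr do rewrite ratr_int.
by move=> j _; rewrite ratr_int exprMn.
Qed.

Lemma term_le_house m (b : nat -> int) j : (j < deg d m)%N ->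
  `|b j|%:~R * mono d varpi m j <= house R (integral_combination m b).
Proof.
move=> lt_j; rewrite -(@ler_pXn2r _ 2) ?nnegrE ?house_ge0 //; last first.
  by rewrite mulr_ge0 // ?ler0z // (le_trans ler01 (mono_ge1 _ _)).
apply: le_trans (sum_le_house m b).
rewrite (bigD1 (Ordinal lt_j)) //= exprMn intr_norm real_normK ?num_real //.
by rewrite lerDl sumr_ge0 // => i _; rewrite mulr_ge0 ?sqr_ge0.
Qed.

(** By [term_le_house] the coefficients on the integral basis are bounded. *)
Lemma finite_level m (X : R) :
  finite_set [set a | [/\ a \in level m, a \in Aint & house R a < X]].
Proof.
pose B := (Num.truncn X).+1; pose D := deg d m.
(* Coefficients in the interval from [- B] to [B], encoded by a shift. *)
pose F (f : {ffun 'I_D -> 'I_(B + B).+1}) :=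
  integral_combination m (fun j => if insub j is Some i then (f i)%:Z - B%:Z else 0).
apply: (@sub_finite_set _ _ (F @` [set: _])); last exact/finite_image/finite_finset.
move=> a /= [aL aA aX]; have [b bE] := integer_level aL aA.
have b_le j : (j < D)%N -> (`|b j| <= B%:Z).
  move=> lt_j; rewrite -(ler_int R) ltW //.
  apply: le_lt_trans (truncnS_gt X); apply: le_trans (ltW aX).
  rewrite bE; apply: le_trans (term_le_house b lt_j).
  by rewrite -[leLHS]mulr1 ler_wpM2l ?ler0z // mono_ge1.
exists [ffun j : 'I_D => inord `|(b j + B%:Z)%R|%N] => //.
rewrite bE; apply: eq_bigr => j _; congr (_%:~R * _).
rewrite insubT ?ltn_ord //= => lt_j; rewrite ffunE /=.
have bj := b_le _ lt_j; rewrite ler_norml in bj; case/andP: bj => bj1 bj2.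
have bB_ge0 : 0 <= b j + B%:Z by rewrite -lerBlDr sub0r.
rewrite inordK; first by rewrite gez0_abs // addrK.
rewrite ltnS -lez_nat gez0_abs // PoszD lerD //.
Qed.

(** A radical that occurs in [a] has absolute value at most the house of [a]. *)
Lemma house_lt_level k0 a : ring_of_integers tower a ->
  (forall k, (k0 <= k)%N -> house R a < varpi k) -> a \in level k0.
Proof.
move=> [/towerP[m aL] aA] a_lt; have [b bE] := integer_level aL aA.
rewrite bE; apply: integral_combination_level => j k lt_j bj /andP[k_ge km].
apply/eqP/negPn/negP => jk; have := a_lt k k_ge; apply/negP; rewrite bE -leNgt.
apply: le_trans (term_le_house b lt_j).
apply: le_trans (varpi_le_mono km jk) _; rewrite ler_peMl //.
  exact: le_trans (mono_ge1 _ _).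
by rewrite -[1]/(1%:~R) ler_int -gtz0_ge1 normr_gt0.
Qed.

Lemma finite_house_lt (X : R) k0 : (forall k, (k0 <= k)%N -> X <= varpi k) ->
  finite_set [set a | ring_of_integers tower a /\ house R a < X].
Proof.
move=> varpi_ge; apply: sub_finite_set (finite_level k0 X) => a /= [aO aX].
split=> //; last by case: aO.
by apply: house_lt_level => // k /varpi_ge; apply: lt_le_trans.
Qed.
End Houses.
End Tower.

(** * Prescribing the Northcott number *)

Lemma northcott_houseE (R : realType) (S : set algC) (t : R) : 0 <= t ->
  (forall X, X < t -> finite_set [set a | S a /\ house R a < X]) ->
  (forall X, t < X -> infinite_set [set a | S a /\ house R a < X]) ->
  northcott_house R S = t%:E.
Proof.
move=> t_ge0 finS infS; apply/eqP; rewrite eq_le; apply/andP; split.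
  apply/lee_addgt0Pr => e e_gt0; rewrite -EFinD; apply: ereal_inf_lbound.
  exists (t + e) => //=; split; first by rewrite addr_ge0 // ltW.
  by apply: infS; rewrite ltrDl.
apply/ereal_infP => _ [X [_ XS] <-]; rewrite lee_fin leNgt.
by apply/negP => /finS.
Qed.

Lemma exists_radical_tower (R : realType) (a b : nat -> R) :
  (forall k, 1 <= a k) -> (forall k, a k < b k) ->
  exists d n (varpi : nat -> R), [/\ radical_system d n,
    forall k, varpi k ^+ d k = (n k)%:R, forall k, 1 <= varpi k &
    forall k, a k < varpi k < b k].
Proof.
move=> a1 ab; have [d [n [sys nab]]] := exists_radical_system a1 ab.
have d_gt0 k : (0 < d k)%N := prime_gt0 (rs_prime sys k).
pose varpi k : R := ComplexField.Normc.normc ((d k).-root (n k)%:R : R[i]).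
have varpi_ge0 k : 0 <= varpi k := normc_ge0 _.
have varpiX k : varpi k ^+ d k = (n k)%:R by rewrite -normcX rootCK // normc_nat.
have varpi_ab k : a k < varpi k < b k.
  have a_ge0 := le_trans ler01 (a1 k); have b_ge0 := ltW (le_lt_trans a_ge0 (ab k)).
  have /andP[an nb] := nab k.
  by apply/andP; split; rewrite -(ltr_pXn2r (d_gt0 k)) ?nnegrE ?varpiX.
exists d, n, varpi; split=> // k; have /andP[/ltW + _] := varpi_ab k.
exact: le_trans (a1 k).
Qed.

Lemma infinite_radicals d n (f : nat -> nat) (S : set algC) :
  radical_system d n -> injective f -> (forall v, S (radical d n (f v))) ->
  infinite_set S.
Proof.
move=> sys f_inj Sf finS; apply: infinite_nat.
have -> : [set: nat] = (fun v => radical d n (f v)) @^-1` S.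
  by apply/seteqP; split=> v _ //=; apply: Sf.
by apply: finite_preimage finS => u v _ _ /(radical_inj sys)/f_inj.
Qed.

Lemma exists_inv_lt (R : realType) (e : R) : 0 < e ->
  exists k0, forall k, (k0 <= k)%N -> (k.+1)%:R^-1 < e.
Proof.
move=> e_gt0; exists (Num.truncn e^-1) => k le_k.
rewrite -[ltRHS]invrK ltf_pV2 ?posrE ?invr_gt0 ?ltr0n //.
apply: lt_le_trans (truncnS_gt _) _; by rewrite ler_nat.
Qed.

Section Cases.
Variables (R : realType) (t : R).
Hypothesis ht : 1 < t.
Let t_gt0 : 0 < t. Proof. exact: lt_trans ht. Qed.
Let inv_gt0 k : 0 < (k.+1)%:R^-1 :> R. Proof. by rewrite invr_gt0 ltr0n. Qed.

(** Radicals of absolute value less than [t], tending to [t]. *)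
Lemma exists_houses_below : exists K : {pred algC},
  [/\ subfield_of_algC K,
      northcott_house R (ring_of_integers K) = t%:E &
      infinite_set [set a | ring_of_integers K a /\ house R a < t]].
Proof.
pose a k : R := t - (t - 1) * (k.+1)%:R^-1.
have t1_gt0 : 0 < t - 1 by rewrite subr_gt0.
have a_ge1 k : 1 <= a k.
  have : (k.+1)%:R^-1 <= 1 :> R by rewrite invf_le1 ?ltr0n // ler1n.
  rewrite -[_ <= 1]subr_ge0 => u_le; rewrite -subr_ge0 /a.
  have := mulr_ge0 (ltW t1_gt0) u_le; rewrite mulrBr mulr1; congr (_ <= _).
  by rewrite addrAC.
have a_lt k : a k < t by rewrite /a ltrBlDr ltrDl mulr_gt0.
have [d [n [varpi [sys varpiX varpi1 varpi_ab]]]] := exists_radical_tower a_ge1 a_lt.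
have inf_lt : infinite_set [set x | ring_of_integers (tower d n) x /\ house R x < t].
  apply: (infinite_radicals sys (f := id)) => // v /=; split.
    exact: radical_integers.
  by rewrite (house_radical sys varpiX varpi1); case/andP: (varpi_ab v).
exists (tower d n); split=> //; first exact: tower_subfield.
apply: northcott_houseE => [|X X_lt|X X_gt]; first exact: ltW.
  have [|k0 hk0] := @exists_inv_lt R ((t - X) / (t - 1)).
    by rewrite divr_gt0 // subr_gt0.
  apply: (finite_house_lt sys varpiX varpi1 (k0 := k0)) => k /hk0.
  rewrite ltr_pdivlMr // => h; apply: ltW; case/andP: (varpi_ab k) => + _.
  by apply: lt_trans; rewrite /a ltrBrDr -ltrBrDl mulrC.
apply: sub_infinite_set inf_lt => x [xK xt]; split=> //=.
exact: lt_trans X_gt.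
Qed.

(** In the Parseval inequality a term that involves [radical k] already exceeds
    [t ^ 2].  Then the bounds on [M] leave no room for a second term (adding at
    least 1), for a coefficient other than 1 and -1 (giving at least
    [4 t ^ 2]), or for a second radical factor (giving at least [t ^ 4]). *)
Lemma house_lt_eq_radical d n (varpi : nat -> R) (M : R) k0 x :
  radical_system d n -> (forall k, varpi k ^+ d k = (n k)%:R) ->
  (forall k, t < varpi k) -> 0 <= M -> M <= t ^+ 2 -> M ^+ 2 <= t ^+ 2 + 1 ->
  ring_of_integers (tower d n) x -> house R x < M -> x \notin level d n k0 ->
  exists2 k, (k0 <= k)%N & x = radical d n k \/ x = - radical d n k.
Proof.
move=> sys varpiX varpi_gt M_ge0 M_le2 M2_le [/towerP[m xm] xA] xM xk0.
have varpi1 k : 1 <= varpi k by apply: ltW; apply: lt_trans (varpi_gt k).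
have [b bE] := integer_level sys xm xA.
have [j [k [lt_j bj /andP[k_ge km] jk]]] : exists j k,
    [/\ (j < deg d m)%N, b j != 0, (k0 <= k < m)%N & (j %% d k != 0)%N].
  apply: contrapT => H; move: xk0; rewrite bE => /negP; apply.
  apply: integral_combination_level => // i k lt_i bi ki; apply/eqP/negPn/negP => ik.
  by apply: H; exists i, k.
exists k => //.
have sumM : \sum_(i < deg d m) (b i)%:~R ^+ 2 * mono d varpi m i ^+ 2 < M ^+ 2.
  apply: le_lt_trans (sum_le_house sys varpiX m b) _.
  by rewrite -bE ltr_pXn2r // ?nnegrE ?house_ge0.
have sq_ge1 i : b i != 0 -> 1 <= (b i)%:~R ^+ 2 :> R.
  move=> bi; rewrite -real_normK ?num_real // exprn_ege1 // -intr_norm -[1]/(1%:~R).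
  by rewrite ler_int -gtz0_ge1 normr_gt0.
have mono2_ge1 i : 1 <= mono d varpi m i ^+ 2 by rewrite exprn_ege1 // mono_ge1.
have term_ge0 i : 0 <= (b i)%:~R ^+ 2 * mono d varpi m i ^+ 2 :> R.
  by rewrite mulr_ge0 // sqr_ge0.
rewrite (bigD1 (Ordinal lt_j)) //= in sumM.
have mono_gt : t < mono d varpi m j.
  by apply: lt_le_trans (varpi_gt k) _; apply: varpi_le_mono.
have mono2_gt : t ^+ 2 < mono d varpi m j ^+ 2.
  by rewrite ltr_pXn2r // nnegrE ltW // (lt_trans t_gt0).
have others (i : 'I_(deg d m)) : i != Ordinal lt_j -> b i = 0.
  move=> ij; apply/eqP/negPn/negP => bi; move: sumM; apply/negP; rewrite -leNgt.
  rewrite (bigD1 i) //=; apply: le_trans M2_le _; rewrite lerD //.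
    apply: le_trans (ltW mono2_gt) _; rewrite ler_peMl ?sq_ge1 //.
    exact: le_trans ler01 (mono2_ge1 j).
  rewrite -[leLHS]addr0 lerD //; last by apply: sumr_ge0.
  by rewrite -[leLHS]mulr1 ler_pM ?sq_ge1.
have xE : x = (b j)%:~R * mono d (radical d n) m j.
  rewrite bE /integral_combination (bigD1 (Ordinal lt_j)) //= big1 ?addr0 //.
  by move=> i /others ->; rewrite mul0r.
rewrite big1 ?addr0 in sumM; last by move=> i /others ->; rewrite expr0n mul0r.
have mono_lt : mono d varpi m j < t ^+ 2.
  apply: lt_le_trans M_le2; rewrite -(@ltr_pXn2r _ 2) ?nnegrE //; last first.
    exact: le_trans ler01 (mono_ge1 d varpi1 m j).
  apply: le_lt_trans sumM; rewrite ler_peMl ?sq_ge1 //.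
  exact: le_trans ler01 (mono2_ge1 j).
have b1 : `|b j| = 1.
  apply/eqP; rewrite eq_le andbC -gtz0_ge1 normr_gt0 bj /=.
  rewrite leNgt; apply/negP => b_gt1.
  have b2 : 2%:R <= `|(b j)%:~R| :> R by rewrite -intr_norm -[2%:R]/(2%:~R) ler_int.
  move: sumM; apply/negP; rewrite -leNgt; apply: le_trans M2_le _.
  apply: le_trans (_ : 2%:R * mono d varpi m j ^+ 2 <= _).
    have : 1 <= t ^+ 2 by rewrite exprn_ege1 // ltW.
    by move: mono2_gt; move: (mono _ _ _ _ ^+ 2) (t ^+ 2) => u v; lra.
  rewrite ler_wpM2r ?sqr_ge0 // -real_normK ?num_real //.
  by apply: (le_trans b2); rewrite -[leLHS]expr1 ler_weXn2l // (le_trans _ b2) // ler1n.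
have [y monoE [y1 y_ge]] := mono_split d varpi1 j km.
have jk1 : (j %% d k = 1)%N.
  apply/eqP; rewrite eqn_leq lt0n jk andbT leqNgt; apply/negP => jk2.
  move: mono_lt; apply/negP; rewrite -leNgt monoE -[leLHS]mulr1 ler_pM //.
    by rewrite exprn_ge0 // ltW.
  apply: le_trans (_ : varpi k ^+ 2 <= _); last by rewrite ler_weXn2l.
  by rewrite lerXn2r ?nnegrE // ltW // (lt_trans t_gt0).
have jl l : (l < m)%N -> l != k -> (j %% d l = 0)%N.
  move=> lm lk; apply/eqP/negPn/negP => jl0.
  move: mono_lt; apply/negP; rewrite -leNgt monoE jk1 expr1 expr2 ler_pM ?(ltW t_gt0) //.
    exact: ltW.
  by apply: le_trans (ltW (varpi_gt l)) _; apply: y_ge.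
have radE : mono d (radical d n) m j = radical d n k.
  rewrite /mono (bigD1 (Ordinal km)) //= jk1 expr1 big1 ?mulr1 // => i ik.
  by rewrite jl ?expr0.
rewrite xE radE; have /eqP : `|b j| = 1 by [].
rewrite eqr_norml => /andP[/orP[]/eqP-> _]; first by left; rewrite mul1r.
by right; rewrite mulN1r.
Qed.

(** Radicals of absolute value greater than [t], tending to [t]. *)
Lemma exists_houses_above : exists M : R, t < M /\
  exists K : {pred algC},
    [/\ subfield_of_algC K,
        northcott_house R (ring_of_integers K) = t%:E &
        forall eps : R, 0 < eps ->
          finite_set [set a | ring_of_integers K a /\
            (house R a <= t \/ t + eps <= house R a < M)]].
Proof.
have t2_gt : t < t ^+ 2 by rewrite expr2 ltr_pMr.
pose s := Num.sqrt (t ^+ 2 + 1).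
have s2 : s ^+ 2 = t ^+ 2 + 1 by rewrite sqr_sqrtr // addr_ge0 ?sqr_ge0.
have s_gt : t < s.
  by rewrite -(@ltr_pXn2r _ 2) ?nnegrE ?sqrtr_ge0 ?(ltW t_gt0) // s2 ltrDl.
have [M [M_gt M_le2 M_les]] : exists M, [/\ t < M, M <= t ^+ 2 & M <= s].
  exists (Num.min (t ^+ 2) s); split; last 2 first.
  - by rewrite ge_min lexx.
  - by rewrite ge_min lexx orbT.
  - by rewrite lt_min t2_gt.
have M_ge0 : 0 <= M by rewrite ltW // (lt_trans t_gt0).
have M2_le : M ^+ 2 <= t ^+ 2 + 1.
  by rewrite -s2 lerXn2r // nnegrE sqrtr_ge0.
exists M; split=> //.
have t_lt k : t < t + (k.+1)%:R^-1 by rewrite ltrDl.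
have [d [n [varpi [sys varpiX varpi1 varpi_ab]]]] :=
  exists_radical_tower (fun=> ltW ht) t_lt.
have varpi_gt k : t < varpi k by case/andP: (varpi_ab k).
exists (tower d n); split; first exact: tower_subfield.
  apply: northcott_houseE => [|X X_lt|X X_gt]; first exact: ltW.
    apply: (finite_house_lt sys varpiX varpi1 (k0 := 0%N)) => k _.
    exact/ltW/(lt_trans X_lt).
  have [|k0 hk0] := @exists_inv_lt R (X - t); first by rewrite subr_gt0.
  apply: (infinite_radicals sys (f := addn k0)); first exact: addnI.
  move=> v; split; first exact: radical_integers.
  rewrite (house_radical sys varpiX varpi1); case/andP: (varpi_ab (k0 + v)) => _.
  move=> /lt_trans; apply; rewrite addrC -ltrBrDr; apply: hk0; exact: leq_addr.
move=> eps eps_gt0; have [k0 hk0] := exists_inv_lt eps_gt0.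
apply: sub_finite_set (finite_level sys varpiX varpi1 k0 M) => x /= [xO xh].
have xM : house R x < M by case: xh => [/le_lt_trans->|/andP[]].
split=> //; last by case: xO.
apply/negPn/negP => xk0.
have [k k_ge xE] := house_lt_eq_radical sys varpiX varpi_gt M_ge0 M_le2 M2_le xO xM xk0.
have hx : house R x = varpi k.
  case: xE => ->; first exact: house_radical.
  exact: house_radicalN.
case: xh; rewrite hx; first by rewrite leNgt varpi_gt.
case/andP: (varpi_ab k) => _ varpi_lt /andP[+ _]; apply/negP; rewrite -ltNge.
apply: lt_trans varpi_lt _; rewrite ltrD2l; exact: hk0.
Qed.

(** Indices [k] encode pairs [(u, v)], and the radical of index [k] has absolute
    value between [t + 1 / (u + 1)] and [t + 1 / (u + 1) + 1 / (v + 1)].  So the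
    absolute values accumulate at every [t + 1 / (u + 1)], all of them
    remaining greater than [t]. *)
Lemma exists_houses_accumulating : exists K : {pred algC},
  [/\ subfield_of_algC K,
      northcott_house R (ring_of_integers K) = t%:E,
      finite_set [set a | ring_of_integers K a /\ house R a <= t] &
      forall M : R, t < M ->
        exists2 eps0 : R, 0 < eps0 &
          forall eps : R, 0 < eps < eps0 ->
            infinite_set [set a | ring_of_integers K a /\
              t + eps <= house R a < M]].
Proof.
pose uv k : nat * nat := odflt (0, 0)%N (unpickle k).
pose a k : R := t + ((uv k).1.+1)%:R^-1.
pose b k : R := a k + ((uv k).2.+1)%:R^-1.
have a_gt k : t < a k by rewrite ltrDl.
have a_ge1 k : 1 <= a k by apply: ltW; apply: lt_trans (a_gt k).
have ab k : a k < b k by rewrite ltrDl.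
have [d [n [varpi [sys varpiX varpi1 varpi_ab]]]] := exists_radical_tower a_ge1 ab.
have varpi_gt k : t < varpi k.
  by case/andP: (varpi_ab k) => + _; apply: lt_trans.
have inf_between M : t < M -> exists2 eps0 : R, 0 < eps0 &
    forall eps : R, 0 < eps < eps0 ->
      infinite_set [set x | ring_of_integers (tower d n) x /\ t + eps <= house R x < M].
  move=> M_gt; have M2 : 0 < (M - t) / 2 by rewrite divr_gt0 // subr_gt0.
  have [u hu] := exists_inv_lt M2; exists (u.+1)%:R^-1 => // eps /andP[_ eps_lt].
  apply: (infinite_radicals sys (f := fun v => pickle (u, (u + v)%N))).
    by move=> v w /(pcan_inj pickleK)[] /addnI.
  move=> v; split; first exact: radical_integers.
  rewrite (house_radical sys varpiX varpi1); move: (varpi_ab (pickle (u, (u + v)%N))).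
  rewrite /b /a /uv pickleK /= => /andP[lo hi]; apply/andP; split.
    by apply: le_trans (ltW lo); rewrite lerD2l ltW.
  have h1 := hu u (leqnn u); have h2 := hu (u + v)%N (leq_addr v u).
  apply: lt_trans hi _.
  have := ltrD h1 h2; rewrite -splitr => h; rewrite -addrA -ltrBrDl //.
exists (tower d n); split=> //; first exact: tower_subfield.
  apply: northcott_houseE => [|X X_lt|X X_gt]; first exact: ltW.
    apply: (finite_house_lt sys varpiX varpi1 (k0 := 0%N)) => k _.
    exact/ltW/(lt_trans X_lt).
  have [eps0 eps0_gt0 inf] := inf_between X X_gt.
  apply: sub_infinite_set (inf (eps0 / 2) _) => [x [xO /andP[_ xX]] //|].
  by rewrite divr_gt0 //= ltr_pdivrMr // ltr_pMr // ltr1n.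
apply: sub_finite_set (finite_level sys varpiX varpi1 0 (t + 1)) => x /= [xO xt].
split; [|by case: xO|by apply: le_lt_trans xt _; rewrite ltrDl].
apply: (house_lt_level sys varpiX varpi1) => // k _.
exact: le_lt_trans xt _.
Qed.
End Cases.

Theorem theorem1 (R : realType) (t : R) (ht : 1 < t) :
  (exists K : {pred algC},
     [/\ subfield_of_algC K,
         northcott_house R (ring_of_integers K) = t%:E &
         infinite_set [set a | ring_of_integers K a /\ house R a < t]])
  /\
  (exists M : R, t < M /\
   exists K : {pred algC},
     [/\ subfield_of_algC K,
         northcott_house R (ring_of_integers K) = t%:E &
         forall eps : R, 0 < eps ->
           finite_set [set a | ring_of_integers K a /\
             (house R a <= t \/ t + eps <= house R a < M)]])
  /\
  (exists K : {pred algC},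
     [/\ subfield_of_algC K,
         northcott_house R (ring_of_integers K) = t%:E,
         finite_set [set a | ring_of_integers K a /\ house R a <= t] &
         forall M : R, t < M ->
           exists2 eps0 : R, 0 < eps0 &
             forall eps : R, 0 < eps < eps0 ->
               infinite_set [set a | ring_of_integers K a /\
                 t + eps <= house R a < M]]).
Proof.
split; first exact: exists_houses_below.
by split; [exact: exists_houses_above | exact: exists_houses_accumulating].
Qed.
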